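(* For each $n\geqslant1$ there exists a constant $\beta(n)>0$ depending only on $n$ such that the following holds. Let $t>0$, let $S(\cdot,t)\colon\mathbb{R}^n\to\mathbb{R}$ be uniformly Lipschitz continuous and let $\tilde J\in I_t(S)$. Let $J_{\mathrm{BVS}}$ be the backward viscosity solution prior associated with $S(\cdot,t)$, and assume that $tJ_{\mathrm{BVS}}$ is twice continuously differentiable and $(1-\alpha)$-semiconvex with $\alpha>0$. Let $\alpha'\in(0,\alpha)$ and let $\mathcal{Y}\subset\mathbb{R}^n$ be a full-dimensional compact convex set. Then $$\delta_\infty(tJ_{\mathrm{BVS}},K,\mathcal{Y})\sim\beta(n)\left(\frac1K\int_{\mathcal{Y}}\left(\det\left(t\nabla_{\bm{y}}^2J_{\mathrm{BVS}}(\bm{y})+(1-\alpha')\bm{I}_{n\times n}\right)\right)^{1/2}d\bm{y}\right)^{2/n}\quad\text{as }K\to+\infty .$$ Moreover, for every $K\geqslant1$ and all points $\bm{x}_1,\dots,\bm{x}_K\in\mathbb{R}^n$ at which $S(\cdot,t)$ is differentiable, the piecewise quadratic minorant $J_{\mathrm{PQM}}$ of margin $\alpha'$ built from these points satisfies $$\delta_\infty(tJ_{\mathrm{BVS}},K,\mathcal{Y})\leqslant t\sup_{\bm{y}\in\mathcal{Y}}\left|\tilde J(\bm{y})-J_{\mathrm{PQM}}(\bm{y})\right| .$$ (The objects $I_t(S)$, $J_{\mathrm{BVS}}$, $J_{\mathrm{PQM}}$ and $\delta_\infty$ are defined in the context.)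
   Context: For $t>0$ and a function $S(\cdot,t)\colon\mathbb{R}^n\to\mathbb{R}$, let $I_t(S)$ be the set of uniformly Lipschitz continuous functions $J\colon\mathbb{R}^n\to\mathbb{R}$ such that $S(\cdot,t)$ is the value at time $t$ of the unique viscosity solution of the Hamilton--Jacobi initial value problem $\partial_t S+\frac12\|\nabla_{\bm{x}}S\|_2^2=0$ on $\mathbb{R}^n\times(0,+\infty)$, $S(\cdot,0)=J$. This viscosity solution is given by the Lax--Oleinik formula, so $J\in I_t(S)$ means that $J$ is uniformly Lipschitz continuous and $S(\bm{x},t)=\inf_{\bm{y}\in\mathbb{R}^n}\{\frac{1}{2t}\|\bm{x}-\bm{y}\|_2^2+J(\bm{y})\}$ for every $\bm{x}\in\mathbb{R}^n$. The backward viscosity solution prior is $J_{\mathrm{BVS}}(\bm{y})=\sup_{\bm{x}\in\mathbb{R}^n}\{S(\bm{x},t)-\frac{1}{2t}\|\bm{x}-\bm{y}\|_2^2\}$. A function $g\colon\mathbb{R}^n\to\mathbb{R}$ is $C$-semiconvex if $\bm{y}\mapsto g(\bm{y})+\frac{C}{2}\|\bm{y}\|_2^2$ is convex. Piecewise quadratic minorant: given points $\bm{x}_1,\dots,\bm{x}_K$ at which $S(\cdot,t)$ is differentiable, put $\bm{y}_k=\bm{x}_k-t\nabla_{\bm{x}}S(\bm{x}_k,t)$. The piecewise quadratic minorant of margin $\alpha'$ is the function $J_{\mathrm{PQM}}$ defined by $$tJ_{\mathrm{PQM}}(\bm{y})+\tfrac12\|\bm{y}\|_2^2=\max_{k\in\{1,\dots,K\}}\left\{tJ_{\mathrm{BVS}}(\bm{y}_k)+\tfrac12\|\bm{y}_k\|_2^2+\langle\bm{x}_k,\bm{y}-\bm{y}_k\rangle+\tfrac{\alpha'}{2}\|\bm{y}-\bm{y}_k\|_2^2\right\}.$$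 Minimal max-plus error: with $\alpha'$ fixed and $\Psi\colon\mathbb{R}^n\to\mathbb{R}$, consider functions of the form $$\Psi_{\mathrm{MP}}(\bm{y})=\max_{k\in\{1,\dots,K\}}\left\{\langle\bm{p}_k,\bm{y}\rangle-\tfrac{1-\alpha'}{2}\|\bm{y}\|_2^2-a(\bm{p}_k)\right\},$$ where $\bm{p}_1,\dots,\bm{p}_K\in\mathbb{R}^n$ and $a\colon\mathbb{R}^n\to\mathbb{R}\cup\{+\infty\}$. Then $$\delta_\infty(\Psi,K,\mathcal{Y})=\inf\left\{\sup_{\bm{y}\in\mathcal{Y}}|\Psi(\bm{y})-\Psi_{\mathrm{MP}}(\bm{y})|\ :\ \Psi_{\mathrm{MP}}\text{ of this form with }\Psi_{\mathrm{MP}}\leqslant\Psi\text{ on }\mathbb{R}^n\right\}.$$ The symbol $\sim$ means that the ratio of the two sides tends to $1$. Full-dimensional means having nonempty interior. *)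

(* Defs.v *)
From HB Require Import structures.
From mathcomp Require Import all_boot all_order all_algebra.
From mathcomp Require Import all_classical all_reals all_analysis.

Set Implicit Arguments.
Unset Strict Implicit.
Unset Printing Implicit Defensive.

Import Order.TTheory GRing.Theory Num.Theory.
Import numFieldNormedType.Exports.

Local Open Scope classical_set_scope.
Local Open Scope ring_scope.

(* The product sigma-algebra on R^n, which is also its Borel sigma-algebra. *)
Section measurable_rV.
Context {R : realType} (n : nat).

Let coors (i : 'I_n) (x : 'rV[R]_n) : measurableTypeR R := x ord0 i.

Let rV_set0 : g_sigma_preimage coors set0.
Proof. exact: sigma_algebra0. Qed.

Let rV_setC A : g_sigma_preimage coors A -> g_sigma_preimage coors (~` A).
Proof. exact: sigma_algebraC. Qed.

Let rV_bigcup (F : (set 'rV[R]_n)^nat) :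
  (forall i, g_sigma_preimage coors (F i)) ->
  g_sigma_preimage coors (\bigcup_i (F i)).
Proof. exact: sigma_algebra_bigcup. Qed.

HB.instance Definition _ := @isMeasurable.Build
  default_measure_display
  'rV[R]_n (g_sigma_preimage coors) rV_set0 rV_setC rV_bigcup.

Lemma measurable_rV_coord (i : 'I_n) :
  measurable_fun [set: 'rV[R]_n] (fun x => x ord0 i : measurableTypeR R).
Proof.
move=> _ Y mY; rewrite setTI; apply: sub_sigma_algebra => /=.
rewrite -bigcup_seq/=; exists i => /=; first by rewrite mem_index_enum.
by exists Y => //; rewrite setTI.
Qed.

End measurable_rV.

Lemma measurable_fun_rV (R : realType) n d (T : measurableType d)
    (f : T -> 'rV[R]_n) :
  (forall i, measurable_fun setT (fun x => f x ord0 i : measurableTypeR R)) ->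
  measurable_fun setT f.
Proof.
move=> mf.
suff : g_sigma_preimage (fun i x => f x ord0 i : measurableTypeR R)
    `<=` measurable.
  rewrite (g_sigma_preimage_comp
    (fun i (x : 'rV[R]_n) => x ord0 i : measurableTypeR R) f) => prefS _ A mA.
  by apply: prefS; exists A => //; rewrite setTI.
apply: smallest_sub; first exact: sigma_algebra_measurable.
case: n => [|m] in f mf *; first by rewrite big_ord0.
rewrite -bigcup_mkord_ord; apply: bigcup_sub => i Ii.
by move=> A [B mB <-]; exact: mf.
Qed.

Section lebesgue_measure_rV.
Context {R : realType}.

Definition rV_cons n (p : measurableTypeR R * 'rV[R]_n) : 'rV[R]_n.+1 :=
  \row_(i < n.+1) (if unlift ord0 i is Some j then p.2 ord0 j else p.1).

Definition rV_uncons n (x : 'rV[R]_n.+1) : measurableTypeR R * 'rV[R]_n :=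
  (x ord0 ord0, \row_(j < n) x ord0 (lift ord0 j)).

Lemma rV_consK n : cancel (@rV_cons n) (@rV_uncons n).
Proof.
move=> [a v]; rewrite /rV_uncons !mxE unlift_none; congr pair.
by apply/rowP => j; rewrite !mxE liftK.
Qed.

Lemma measurable_rV_cons n : measurable_fun setT (@rV_cons n).
Proof.
apply: measurable_fun_rV => i; under eq_fun do rewrite mxE.
case: unliftP => [j|] _ /=; last exact: measurable_fst.
exact: (measurableT_comp (measurable_rV_coord j) measurable_snd).
Qed.

Lemma measurable_rV_uncons n : measurable_fun setT (@rV_uncons n).
Proof.
apply: measurable_fun_pair; first exact: measurable_rV_coord.
apply: measurable_fun_rV => i; under eq_fun do rewrite mxE.
exact: measurable_rV_coord.
Qed.

Section step.
Context n (mu : {sigma_finite_measure set 'rV[R]_n -> \bar R}).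

Definition lebesgue_rV_step : set 'rV[R]_n.+1 -> \bar R :=
  pushforward (lebesgue_measure \x mu)%E (@rV_cons n).

Local Notation nu := lebesgue_rV_step.

Let mcons A : measurable A ->
  measurable (@rV_cons n @^-1` A).
Proof.
by move=> mA; rewrite -[X in measurable X]setTI; exact: measurable_rV_cons.
Qed.

Let nu0 : nu set0 = 0%E.
Proof. by rewrite /nu /pushforward preimage_set0 measure0. Qed.

Let nu_ge0 A : (0 <= nu A)%E.
Proof. by rewrite /nu /pushforward; exact: measure_ge0. Qed.

Let nu_sigma_additive : semi_sigma_additive nu.
Proof.
move=> F mF tF mUF; rewrite /nu /pushforward preimage_bigcup.
apply: measure_semi_sigma_additive.
- by move=> k; exact: mcons.
- apply/trivIsetP => /= i j _ _ ij; rewrite -preimage_setI.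
  by move/trivIsetP : tF => /(_ _ _ _ _ ij) ->//; rewrite preimage_set0.
- by rewrite -preimage_bigcup; exact: mcons.
Qed.

HB.instance Definition _ := isMeasure.Build _ _ _ nu
  nu0 nu_ge0 nu_sigma_additive.

Let nu_sigma_finite : sigma_finite setT nu.
Proof.
have /sigma_finiteP[F [FT ndF Foo]] :=
  sigma_finiteT (@lebesgue_measure R : {sigma_finite_measure set _ -> \bar R}).
have /sigma_finiteP[G [GT ndG Goo]] := sigma_finiteT mu.
exists (fun k => @rV_uncons n @^-1` (F k `*` G k)).
  rewrite -preimage_bigcup (_ : \bigcup_k _ = setT) ?preimage_setT//.
  apply/seteqP; split => // -[a v] _.
  have [i _ Fia] : (\bigcup_k F k) a by rewrite -FT.
  have [j _ Gjv] : (\bigcup_k G k) v by rewrite -GT.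
  exists (maxn i j) => //; split => /=.
    by move: Fia; exact/subsetPset/ndF/leq_maxl.
  by move: Gjv; exact/subsetPset/ndG/leq_maxr.
move=> k; have [mFk Fk] := Foo k; have [mGk Gk] := Goo k; split.
  rewrite -[X in measurable X]setTI.
  by apply: measurable_rV_uncons => //; exact: measurableX.
rewrite /nu /pushforward -comp_preimage (_ : _ \o _ = id); last first.
  by apply/funext; exact: rV_consK.
by rewrite preimage_id product_measure1E// lte_mul_pinfty// ge0_fin_numE.
Qed.

HB.instance Definition _ := Measure_isSigmaFinite.Build _ _ _ nu
  nu_sigma_finite.

End step.

(* n-dimensional Lebesgue measure, as the n-fold product of lebesgue_measure;
   see lebesgue_rV_box. *)
Fixpoint lebesgue_rV n : {sigma_finite_measure set 'rV[R]_n -> \bar R} :=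
  match n with
  | 0 => dirac (0 : 'rV[R]_0)
  | m.+1 => lebesgue_rV_step (lebesgue_rV m)
  end.

Lemma lebesgue_rV_box n (A : 'I_n -> set (measurableTypeR R)) :
  (forall i, measurable (A i)) ->
  lebesgue_rV n [set x | forall i, A i (x ord0 i)] =
  (\prod_(i < n) lebesgue_measure (A i))%E.
Proof.
elim: n A => [|n IH] A mA.
  rewrite big_ord0 /= diracE mem_set//.
  by case.
rewrite big_ord_recl -IH; last by move=> i; exact: mA.
set B := (X in _ = (_ * lebesgue_rV n X)%E).
rewrite -product_measure1E//; last first.
  rewrite (_ : B = \bigcap_(i in [set: 'I_n])
      ((fun x : 'rV[R]_n => x ord0 i : measurableTypeR R) @^-1` A (lift ord0 i))).
    apply: fin_bigcap_measurable => // i _.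
    by rewrite -[X in measurable X]setTI; exact: measurable_rV_coord.
  by apply/seteqP; split => [x Bx i _|x Bx i]; [exact: Bx|exact: (Bx i I)].
congr ((lebesgue_measure \x lebesgue_rV n)%E _).
apply/seteqP; split => [[a v] /= h|[a v] /= [ha hv] i].
  split; first by have := h ord0; rewrite mxE unlift_none.
  by move=> i; have := h (lift ord0 i); rewrite mxE liftK.
rewrite mxE; case: unliftP => [j ->|->//]; exact: hv.
Qed.

End lebesgue_measure_rV.

Section euclidean.
Context {R : realType} {n : nat}.
Implicit Types (u v x y : 'rV[R]_n) (f g : 'rV[R]_n -> R).

(* The norm `| | that the library puts on 'rV[R]_n is the sup norm; it yields
   the same topology, Lipschitz functions and differentials. *)
Definition dotv u v : R := \sum_(i < n) u ord0 i * v ord0 i.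

Definition sqnorm u : R := dotv u u.

Definition gradient f x : 'rV[R]_n := \row_(i < n) 'D_(delta_mx ord0 i) f x.

Definition hessian f x : 'M[R]_n :=
  \matrix_(i < n, j < n) 'D_(delta_mx ord0 i) ('D_(delta_mx ord0 j) f) x.

Definition twice_continuously_differentiable f : Prop :=
  [/\ forall x, differentiable f x,
      forall x, differentiable (gradient f) x &
      continuous (hessian f)].

Definition semiconvex (C : R) g : Prop :=
  convex_function setT (fun y => g y + C / 2 * sqnorm y).

End euclidean.

Section hamilton_jacobi.
Context {R : realType} {n : nat}.
Implicit Types (t : R) (S J : 'rV[R]_n -> R) (Y : set 'rV[R]_n).

(* The viscosity solution at time t of
   dS/dt + |grad S|^2 / 2 = 0 with initial data J. *)
Definition lax_oleinik t J (x : 'rV[R]_n) : \bar R :=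
  ereal_inf [set ((2 * t)^-1 * sqnorm (x - y) + J y)%:E | y in setT].

(* The set I_t(S), where S stands for S(., t). *)
Definition initial_data t S : set ('rV[R]_n -> R) :=
  [set J | lipschitz J /\ forall x, (S x)%:E = lax_oleinik t J x].

(* The supremum is over a nonempty set, bounded above by J y for any J in
   [initial_data t S]. *)
Definition J_BVS t S (y : 'rV[R]_n) : R :=
  sup [set S x - (2 * t)^-1 * sqnorm (x - y) | x in setT].

(* Defined by t J y + |y|^2 / 2 = max_k { ... }, solved for J y. The maximum is
   taken in \bar R, where -oo is neutral; it is finite when 0 < K. *)
Definition J_PQM t S (alpha' : R) (K : nat) (x : 'I_K -> 'rV[R]_n)
    (y : 'rV[R]_n) : R :=
  let yk k := x k - t *: gradient S (x k) in
  t^-1 * (fine (\big[maxe/-oo%E]_(k < K)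
             (t * J_BVS t S (yk k) + sqnorm (yk k) / 2
              + dotv (x k) (y - yk k) + alpha' / 2 * sqnorm (y - yk k))%:E)
          - sqnorm y / 2).

Definition Psi_MP (alpha' : R) (K : nat) (p : 'I_K -> 'rV[R]_n)
    (a : 'rV[R]_n -> \bar R) (y : 'rV[R]_n) : \bar R :=
  (\big[maxe/-oo]_(k < K)
     ((dotv (p k) y - (1 - alpha') / 2 * sqnorm y)%:E - a (p k)))%E.

Definition delta_infty (alpha' : R) (Psi : 'rV[R]_n -> R) (K : nat) Y : \bar R :=
  ereal_inf [set e | exists (p : 'I_K -> 'rV[R]_n) (a : 'rV[R]_n -> \bar R),
    [/\ forall q, a q != -oo%E,
        forall y, (Psi_MP alpha' p a y <= (Psi y)%:E)%E &
        e = ereal_sup [set `|(Psi y)%:E - Psi_MP alpha' p a y|%E | y in Y]]].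

End hamilton_jacobi.

(* Main.v *)
Require Import Defs.
From mathcomp Require Import all_boot all_order all_algebra.
From mathcomp Require Import all_classical all_reals all_analysis.
From mathcomp Require Import measurable_realfun.
From mathcomp Require Import ring lra.

Set Implicit Arguments.
Unset Strict Implicit.
Unset Printing Implicit Defensive.

Import Order.TTheory GRing.Theory Num.Theory.
Import numFieldNormedType.Exports.

Local Open Scope classical_set_scope.
Local Open Scope ring_scope.

(** Adding [(1 - alpha') / 2 |y|^2] to [t J_BVS] gives a strongly convex [C^2]
    function [phi], and the admissible [Psi_MP] become maxima of [K] affine
    minorants of [phi]. A best affine minorant is a tangent plane, so
    [delta_infty < d] says that [Y] is covered by [K] Bregman balls
    [{y | D y z <= d}], where [D y z] is the gap at [y] between [phi] and its
    tangent plane at [z]. Near a point [a], these balls are almost the ellipsoids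
    [{y | (y - z) H (y - z)^T <= 2 d}], [H] being the Hessian of [phi] at [a].

    The cost of covering large cubes by ellipsoids of matrix [H] is asymptotically
    [covering_constant H] per unit volume (subadditivity), and a Cholesky
    factorisation together with a lattice tiling shows that this constant is
    [covering_constant 1 * sqrt (det H)]. Cutting [Y] into small cubes on which [H]
    is almost constant turns the count into the integral of [sqrt (det H)].

    For the last inequality, the tangent planes of [t J_BVS + |y|^2 / 2] at the points
    [y_k] have slope [x_k], because [y_k] attains the Lax-Oleinik infimum at [x_k];
    so [t J_PQM] is itself an admissible [Psi_MP], and
    [J_PQM <= J_BVS <= Jtilde]. *)

(** * Coverings by translates of ellipsoids *)

Section covering.
Context {R : realType} {n : nat}.
Implicit Types (H A : 'M[R]_n) (u v a c y : 'rV[R]_n) (X : set 'rV[R]_n).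

(** A Bregman ball [{2 * D <= r ^ 2}] means an error [r ^ 2 / 2], and the number [K] of balls
    satisfies [K r ^ n ~ covering_constant 1 * I], [I] being the integral; solving for [r] gives the
    exponent [2 / n] and [beta = covering_constant 1 ^ (2 / n) / 2]. The margin [alpha' < alpha]
    gives [phi] the modulus [alpha - alpha' > 0]. It confines Bregman balls of small radius to small
    cubes, so that counting is local, and it turns additive errors on the Hessian into factors
    [mu > 1]; each asymptotic bound fixes in advance the power of [mu] that it may spend. The
    determinant enters through triangular matrices because cubes, which are all that is counted and
    measured, are then related by a lattice that also has a box as fundamental domain. The number of
    centres is bounded by a real [x], so that bounds add and multiply without rounding. *)

Definition covers (D : 'rV[R]_n -> 'rV[R]_n -> Prop) X (x : R) : Prop :=
  exists z : seq 'rV[R]_n,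
    (size z)%:R <= x /\ forall y, X y -> exists2 c, c \in z & D y c.

Lemma covers_sub D D' X X' (x x' : R) : covers D X x ->
  X' `<=` X -> (forall y c, X' y -> D y c -> D' y c) -> x <= x' -> covers D' X' x'.
Proof.
move=> [z [zx Dz]] XX' DD' xx'; exists z; split; first exact: le_trans zx xx'.
move=> y X'y; have [c cz Dyc] := Dz y (XX' y X'y).
by exists c => //; exact: DD'.
Qed.

Lemma covers_bigU (T : eqType) (s : seq T) (F : T -> set 'rV[R]_n)
    (f : T -> R) D X :
  (forall i, i \in s -> covers D (F i) (f i)) ->
  (forall y, X y -> exists2 i, i \in s & F i y) ->
  covers D X (\sum_(i <- s) f i).
Proof.
elim: s X => [|i s IH] X cF XF.
  exists [::]; rewrite big_nil; split=> // y /XF[i].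
  by rewrite in_nil.
have [z [zx Dz]] := cF i (mem_head _ _).
have [||z' [zx' Dz']] := IH [set y | exists2 j, j \in s & F j y].
- by move=> j js; apply: cF; rewrite in_cons js orbT.
- by [].
exists (z ++ z'); rewrite big_cons size_cat natrD lerD//; split=> // y /XF[j].
rewrite in_cons => /predU1P[->|js] Fy.
  have [c cz Dc] := Dz y Fy.
  by exists c => //; rewrite mem_cat cz.
have [c cz Dc] := Dz' y (ex_intro2 _ _ j js Fy).
by exists c => //; rewrite mem_cat cz orbT.
Qed.

Definition qform H v : R := (v *m H *m v^T) ord0 ord0.

Lemma qform_congr A H v : qform (A *m H *m A^T) v = qform H (v *m A).
Proof. by rewrite /qform trmx_mul !mulmxA. Qed.

Lemma qformZ H (k : R) v : qform H (k *: v) = k ^+ 2 * qform H v.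
Proof.
by rewrite /qform linearZ /= -!scalemxAl -scalemxAr !mxE mulrA expr2.
Qed.

Lemma qform1 v : qform 1%:M v = sqnorm v.
Proof.
by rewrite /qform mulmx1 mxE; apply: eq_bigr => i _; rewrite mxE.
Qed.

Lemma qformE H v :
  qform H v = \sum_(i < n) \sum_(j < n) v ord0 i * v ord0 j * H i j.
Proof.
rewrite /qform mxE exchange_big; apply: eq_bigr => j _ /=.
rewrite !mxE mulr_suml; apply: eq_bigr => i _; ring.
Qed.

Definition cube a (s : R) : set 'rV[R]_n :=
  [set y | forall i, a ord0 i <= y ord0 i <= a ord0 i + s].

Definition ball_rel H (r : R) : 'rV[R]_n -> 'rV[R]_n -> Prop :=
  fun y c => qform H (y - c) <= r ^+ 2.

Lemma covers_cube_scale H (r k s x : R) a b : 0 < k ->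
  covers (ball_rel H r) (cube a s) x ->
  covers (ball_rel H (k * r)) (cube b (k * s)) x.
Proof.
move=> k0 [z [zx cz]].
exists [seq b + k *: (c - a) | c <- z]; rewrite size_map; split=> // y yb.
have [|c cin] := cz (a + k^-1 *: (y - b)).
  move=> i; have /andP[h1 h2] := yb i; rewrite !mxE lerDl lerD2l.
  rewrite mulr_ge0 ?subr_ge0 ?invr_ge0 ?(ltW k0)//=.
  by rewrite ler_pdivrMl// lerBlDl.
rewrite /ball_rel => hc.
exists (b + k *: (c - a)); first exact: map_f.
have -> : y - (b + k *: (c - a)) = k *: (a + k^-1 *: (y - b) - c).
  by apply/rowP => i; rewrite !mxE; field; rewrite gt_eqF.
by rewrite qformZ exprMn ler_pM2l// exprn_gt0.
Qed.

(** Coordinate [i] ranges over at most [truncn (len i) + 1] offsets from [ceil (lo i)]. As the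
    ranges depend on [i], offsets live in the common type ['I_M] and [family F] cuts them down. *)
Lemma int_box (lo len : 'I_n -> R) : (forall i, 0 <= len i) ->
  exists s : seq {ffun 'I_n -> int},
    (size s)%:R <= \prod_(i < n) (len i + 1) /\
    forall m : {ffun 'I_n -> int},
      (forall i, lo i <= (m i)%:~R <= lo i + len i) -> m \in s.
Proof.
move=> len0; pose N i := (Num.truncn (len i)).+1.
pose M := \max_(i < n) N i.
pose F (i : 'I_n) : pred 'I_M := [pred j : 'I_M | (j < N i)%N].
exists [seq [ffun i => Num.ceil (lo i) + (f i : nat)%:Z] |
         f : {ffun 'I_n -> 'I_M} <- enum (family F)].
split.
  rewrite size_map -cardE card_family foldrE big_image /=.
  rewrite natr_prod; apply: ler_prod => i _; rewrite ler0n /=.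
  have -> : #|F i| = N i.
    have NM : (N i <= M)%N by exact: leq_bigmax.
    by rewrite -sum1_card -(big_ord_widen M (fun=> 1%N))// sum1_card card_ord.
  by rewrite /N -natr1 lerD2r truncn_le.
move=> m hm.
have kP (i : 'I_n) : {k : 'I_M | (k < N i)%N & m i = Num.ceil (lo i) + (k : nat)%:Z}.
  have /andP[h1 h2] := hm i.
  have c1 : Num.ceil (lo i) <= m i by rewrite ceil_le_int.
  have : 0 <= m i - Num.ceil (lo i) by rewrite subr_ge0.
  case E : (m i - Num.ceil (lo i)) => [k|//] _.
  have kN : (k < N i)%N.
    rewrite /N ltnS truncn_ge_nat// -[k%:R]/(k%:Z%:~R) -E intrB lerBlDr.
    by apply: (le_trans h2); rewrite addrC lerD2l ceil_ge.
  have kM : (k < M)%N by rewrite (leq_trans kN)// (leq_bigmax i).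
  by exists (Ordinal kM) => //=; rewrite -E addrC subrK.
apply/mapP; exists [ffun i => s2val (kP i)].
  rewrite mem_enum; apply/familyP => i; rewrite ffunE.
  by case: (kP i).
by apply/ffunP => i; rewrite !ffunE; case: (kP i).
Qed.

Definition upper_trig A : Prop :=
  (forall i j : 'I_n, (j < i)%N -> A i j = 0) /\ (forall i, 0 < A i i).

(* For upper triangular [A], the parallelepiped spanned by the rows of [s A]
   and the box of sides [s A_ii] tile space by the same lattice. *)
Lemma upper_trig_tiling A (s : R) y : upper_trig A -> 0 < s ->
  exists m : {ffun 'I_n -> int},
    cube 0 s ((y - \row_i (s * (m i)%:~R / A i i)) *m A).
Proof.
move=> [A0 Ap] s0; pose g (m : {ffun 'I_n -> int}) : 'rV[R]_n :=
  \row_i (s * (m i)%:~R / A i i).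
(* Coordinates are treated from left to right: [A K j = 0] for [j < K], so choosing [m K] leaves the
   earlier ones unchanged. It moves coordinate [K] by multiples of [s], since [A K K] cancels the
   division in the lattice. *)
suff P (k : nat) : (k <= n)%N -> exists m : {ffun 'I_n -> int},
    forall j : 'I_n, (j < k)%N -> 0 <= ((y - g m) *m A) ord0 j <= s.
  have [m hm] := P n (leqnn n); exists m => j.
  by rewrite mxE add0r; exact: hm.
elim: k => [_|k IH kn]; first by exists [ffun=> 0].
have [m hm] := IH (ltnW kn).
pose K := Ordinal kn.
pose T := \sum_(i < n | i != K) (y ord0 i - s * (m i)%:~R / A i i) * A i K + y ord0 K * A K K.
pose m' : {ffun 'I_n -> int} := [ffun i => if i == K then Num.floor (T / s) else m i].
exists m' => j; rewrite ltnS leq_eqVlt => /predU1P[jk|jk].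
  have -> : j = K by exact: val_inj.
  rewrite mxE (bigD1 K)//= !mxE ffunE eqxx.
  rewrite (eq_bigr (fun i => (y ord0 i - s * (m i)%:~R / A i i) * A i K)); last first.
    by move=> i iK; rewrite !mxE ffunE (negPf iK).
  have -> : (y ord0 K - s * (Num.floor (T / s))%:~R / A K K) * A K K +
     \sum_(i < n | i != K) (y ord0 i - s * (m i)%:~R / A i i) * A i K =
     T - s * (Num.floor (T / s))%:~R.
    by rewrite /T mulrBl divfK ?gt_eqF//; ring.
  rewrite subr_ge0 lerBlDr.
  have f1 : (Num.floor (T / s))%:~R <= T / s by exact: floor_le.
  have f2 : T / s <= (Num.floor (T / s))%:~R + 1.
    by apply: ltW; rewrite -(intrD _ _ 1) floorD1_gt.
  rewrite mulrC -ler_pdivlMr// f1 /=.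
  by move: f2; rewrite ler_pdivrMr// mulrDl mul1r addrC.
suff -> : ((y - g m') *m A) ord0 j = ((y - g m) *m A) ord0 j by exact: hm.
rewrite !mxE; apply: eq_bigr => i _; rewrite !mxE ffunE.
by case: eqP => // ->; rewrite (A0 K j)// !mulr0.
Qed.

End covering.

(** * Covering density of large cubes *)

Section covering_constant.
Context {R : realType} {n : nat}.
Implicit Types (H A : 'M[R]_n) (u v a c y : 'rV[R]_n).

(** Shares an error factor [q] among [k] steps, each of which may lose [tau]. *)
Lemma exp_root_gt1 (q : R) k : 1 < q -> exists2 tau : R, 1 < tau & tau ^+ k <= q.
Proof.
move=> q1; have q0 : 0 < q by rewrite (lt_trans _ q1).
case: k => [|k]; first by exists 2; rewrite ?ltr1n// expr0 ltW.
exists (q `^ (k.+1%:R^-1)).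
  have : 1 `^ k.+1%:R^-1 < q `^ k.+1%:R^-1.
    by rewrite gt0_ltr_powR ?invr_gt0 ?nnegrE ?ler01 ?(ltW q0).
  by rewrite powR1.
by rewrite -powR_mulrn ?powR_ge0// -powRrM mulVf// powRr1// ltW.
Qed.

Lemma ler_gt1P (x y : R) : 0 <= y -> (forall q, 1 < q -> x <= q * y) -> x <= y.
Proof.
move=> y0 h; apply/ler_addgt0Pr => e e0.
have [y_gt0|] := ltP 0 y.
  have /h : 1 < 1 + e / y by rewrite ltrDl divr_gt0.
  by rewrite mulrDl mul1r divfK// gt_eqF.
move=> y0'; have yE : y = 0 by apply/eqP; rewrite eq_le y0' y0.
have := h 2; rewrite yE mulr0 add0r ltr1n => /(_ isT) /le_trans; apply.
exact: ltW.
Qed.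

(* The translates of [cube 0 s *m invmx A] by the lattice of [upper_trig_tiling]
   cover space; the bound counts those that meet [cube 0 L]. *)
Lemma covers_congr A (C s x L : R) H : upper_trig A -> A \in unitmx ->
  (forall i e, cube 0 s e -> `|(e *m invmx A) ord0 i| <= C) ->
  0 < s -> 0 <= L ->
  covers (ball_rel H 1) (cube 0 s) x ->
  covers (ball_rel (A *m H *m A^T) 1) (cube 0 L)
    (x * \prod_(i < n) (A i i * (L + 2 * C) / s + 1)).
Proof.
move=> At Au hC s0 L0 cz.
have [_ Ap] := At.
have C0 (i : 'I_n) : 0 <= C.
  apply: le_trans (hC i 0 _); first by rewrite normr_ge0.
  by move=> j; rewrite mxE add0r lexx ltW.
have x0 : 0 <= x by case: cz => z [+ _]; exact: le_trans.
pose g (m : {ffun 'I_n -> int}) : 'rV[R]_n := \row_i (s * (m i)%:~R / A i i).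
(* A cell meeting [cube 0 L] has its lattice point in [[-C, L + C]] coordinatewise; multiplication
   by [A i i / s] gives the range of [m i]. *)
have [|ms [msN msP]] := @int_box R n (fun i => A i i * (- C) / s)
    (fun i => A i i * (L + 2 * C) / s).
  move=> i; rewrite divr_ge0 ?(ltW s0)// mulr_ge0 ?(ltW (Ap i))//.
  by rewrite addr_ge0// mulr_ge0// (C0 i).
apply: (@covers_sub _ _ (ball_rel (A *m H *m A^T) 1) _
    (cube 0 L) _ (\sum_(m <- ms) x)); last 1 first.
- by rewrite big_const_seq count_predT iter_addr_0 -[_ *+ _]mulr_natr ler_wpM2l.
- apply: (@covers_bigU _ _ _ ms
    (fun m => [set y | cube 0 s ((y - g m) *m A)])).
    move=> m _; have [z [zx hz]] := cz.
    exists [seq g m + c *m invmx A | c <- z]; rewrite size_map; split=> // y yc.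
    have [c cz' hc] := hz _ yc; exists (g m + c *m invmx A); first exact: map_f.
    rewrite /ball_rel qform_congr.
    by rewrite opprD addrA mulmxBl mulmxKV.
  move=> y yL; have [m hm] := upper_trig_tiling y At s0; exists m => //.
  apply: msP => i.
  have := hC i _ hm; rewrite mulmxK// !mxE ler_norml => /andP[h1 h2].
  have /andP[y0 y1] := yL i; rewrite mxE ?add0r in y0 y1.
  have sA : 0 < A i i / s by rewrite divr_gt0.
  have -> : (m i)%:~R = A i i / s * (s * (m i)%:~R / A i i).
    by field; rewrite !gt_eqF.
  have -> : A i i * - C / s = A i i / s * - C by ring.
  have -> : A i i * (L + 2 * C) / s = A i i / s * (L + 2 * C) by ring.
  by rewrite -mulrDr !ler_pM2l//; clear C0; apply/andP; split; lra.
- by [].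
- by [].
Qed.

Definition cover_densities H : set R :=
  [set q | exists L x : R, [/\ 0 < L, covers (ball_rel H 1) (cube 0 L) x
                            & q = x / L ^+ n]].

(* The infimum is also the limit as [L] tends to infinity, see [covering_constant_cover] and
   [covering_constant_covers_large]. *)
Definition covering_constant H : R := inf (cover_densities H).

Lemma covers_ge0 D (X : set 'rV[R]_n) x : covers D X x -> 0 <= x.
Proof. by case=> z [+ _]; exact: le_trans. Qed.

Lemma cover_densities_ge0 H q : cover_densities H q -> 0 <= q.
Proof.
move=> [L [x [L0 /covers_ge0 x0 ->]]].
by rewrite divr_ge0// exprn_ge0// ltW.
Qed.

(** One ball suffices for a small cube: with side [(1 + C)^-1] the form is at most
    [C / (1 + C) ^ 2 <= 1]. *)
Lemma cover_densities_nonempty H : cover_densities H !=set0.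
Proof.
pose C := \sum_i \sum_j `|H i j|.
have C0 : 0 <= C by rewrite sumr_ge0// => i _; rewrite sumr_ge0.
have s0 : 0 < (1 + C)^-1 by rewrite invr_gt0 ltr_wpDr.
exists (1 / (1 + C)^-1 ^+ n), (1 + C)^-1, 1; split=> //.
exists [:: 0]; split=> // y ys; exists 0; rewrite ?mem_head// /ball_rel subr0.
have y1 i : 0 <= y ord0 i <= (1 + C)^-1 by have := ys i; rewrite mxE add0r.
rewrite qformE expr1n; apply: (@le_trans _ _ ((1 + C)^-1 ^+ 2 * C)).
  rewrite mulr_sumr; apply: ler_sum => i _.
  rewrite mulr_sumr; apply: ler_sum => j _.
  have /andP[i0 i1] := y1 i; have /andP[j0 j1] := y1 j.
  apply: (le_trans (ler_norm _)); rewrite normrM ger0_norm ?mulr_ge0//.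
  by rewrite ler_wpM2r// expr2 ler_pM.
rewrite exprVn -ler_pdivlMl ?invr_gt0 ?exprn_gt0 ?ltr_wpDr// invrK mulr1.
rewrite expr2; nra.
Qed.

Lemma covering_constant_le H L x : 0 < L -> covers (ball_rel H 1) (cube 0 L) x ->
  covering_constant H <= x / L ^+ n.
Proof.
move=> L0 cx; apply: ge_inf; last by exists L, x.
by exists 0 => q /cover_densities_ge0.
Qed.

Lemma covering_constant_cover H r a s x : 0 < r -> 0 < s ->
  covers (ball_rel H r) (cube a s) x -> covering_constant H * (s / r) ^+ n <= x.
Proof.
move=> r0 s0 /(@covers_cube_scale _ _ _ _ r^-1 _ _ _ 0).
rewrite invr_gt0 => /(_ r0); rewrite mulVf ?gt_eqF// => /covering_constant_le.
rewrite mulrC => /(_ (divr_gt0 s0 r0)) h.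
by rewrite -ler_pdivlMr// exprn_gt0// divr_gt0.
Qed.

Lemma normr_mulmx_bound (B : 'M[R]_n) (s : R) : 0 < s ->
  forall (i : 'I_n) e, cube 0 s e ->
    `|(e *m B) ord0 i| <= s * \sum_i \sum_j `|B i j|.
Proof.
move=> s0 i e es; rewrite mxE (le_trans (ler_norm_sum _ _ _))//.
rewrite mulr_sumr; apply: ler_sum => j _.
have /andP[e0 e1] := es j; rewrite mxE ?add0r in e0 e1.
rewrite normrM ger0_norm// ler_pM//.
by rewrite (bigD1 i)//= lerDl sumr_ge0.
Qed.

(** The boundary term [d i] is absorbed by [tau] once [d i <= c i * (tau - 1) * L]; the sum in [L0]
    ensures this for all [i] at once, and the summand 1 keeps [L0] positive. *)
Lemma prod_large (c d : 'I_n -> R) (tau : R) : 1 < tau ->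
  (forall i, 0 < c i) -> (forall i, 0 <= d i) ->
  exists2 L0 : R, 0 < L0 & forall L, L0 <= L ->
    \prod_(i < n) (c i * L + d i) <= (tau * L) ^+ n * \prod_(i < n) c i.
Proof.
move=> tau1 c0 d0; exists (1 + \sum_i d i / (c i * (tau - 1))).
  rewrite ltr_pwDl// sumr_ge0// => i _.
  by rewrite divr_ge0// mulr_ge0 ?subr_ge0 ?ltW.
move=> L hL.
have Li i : d i / (c i * (tau - 1)) <= L.
  apply: le_trans hL; rewrite (bigD1 i)//= ler_wpDl// lerDl sumr_ge0// => j _.
  by rewrite divr_ge0// mulr_ge0 ?subr_ge0 ?ltW.
have -> : (tau * L) ^+ n = \prod_(i < n) (tau * L).
  by rewrite prodr_const card_ord.
rewrite -big_split /=; apply: ler_prod => i _; apply/andP; split.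
  rewrite addr_ge0// mulr_ge0 ?(ltW (c0 i))//.
  by apply: le_trans (Li i); rewrite divr_ge0// mulr_ge0 ?subr_ge0 ?ltW.
have := Li i; rewrite ler_pdivrMr ?mulr_gt0 ?subr_gt0//.
by move=> ?; lra.
Qed.

(** One cover is replicated along the lattice of [covers_congr]. The overhang [C] of a cell does not
    depend on [L], so boundary effects cost only a factor [q]. The case [A = 1%:M] spreads the
    density of a single cover to all large cubes. *)
Lemma congr_cover_large A H (s x q : R) : upper_trig A -> A \in unitmx ->
  0 < s -> 1 < q -> covers (ball_rel H 1) (cube 0 s) x ->
  exists2 L0 : R, 0 < L0 & forall L, L0 <= L ->
    covers (ball_rel (A *m H *m A^T) 1) (cube 0 L)
      (q * (x / s ^+ n) * (\prod_(i < n) A i i) * L ^+ n).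
Proof.
move=> At Au s0 q1 cx; have [_ Ap] := At.
pose C := s * \sum_i \sum_j `|invmx A i j|.
have C0 : 0 <= C.
  by rewrite mulr_ge0 ?(ltW s0)// sumr_ge0// => i _; rewrite sumr_ge0.
have [tau tau1 tauq] := exp_root_gt1 n q1.
have [||L0 L00 hL] := @prod_large (fun i => A i i / s)
    (fun i => A i i * (2 * C) / s + 1) _ tau1.
- by move=> i; rewrite divr_gt0.
- move=> i; rewrite addr_ge0// divr_ge0 ?(ltW s0)// mulr_ge0 ?(ltW (Ap i))//.
  exact: mulr_ge0.
exists L0 => // L L0L; have Lp : 0 < L by exact: lt_le_trans L0L.
have := covers_congr At Au (normr_mulmx_bound (invmx A) s0) s0 (ltW Lp) cx.
move=> /covers_sub; apply=> //.
have -> : q * (x / s ^+ n) * (\prod_(i < n) A i i) * L ^+ n =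
    x * (q * L ^+ n * (\prod_(i < n) (A i i / s))).
  rewrite big_split /= prodr_const card_ord exprVn; ring.
rewrite ler_wpM2l ?(covers_ge0 cx)//.
rewrite (eq_bigr (fun i => A i i / s * L + (A i i * (2 * C) / s + 1))); last first.
  by move=> i _; rewrite mulrDr mulrDl addrA -/C; congr (_ + _ + _); ring.
apply: (le_trans (hL L L0L)); rewrite ler_wpM2r//.
  by apply: prodr_ge0 => i _; rewrite divr_ge0// ltW.
by rewrite exprMn ler_wpM2r// exprn_ge0// ltW.
Qed.

Lemma covering_constant_congr_le A H : upper_trig A -> A \in unitmx ->
  covering_constant (A *m H *m A^T) <= covering_constant H * \prod_(i < n) A i i.
Proof.
move=> At Au; have [_ Ap] := At.
have P0 : 0 < \prod_(i < n) A i i by exact: prodr_gt0.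
rewrite -ler_pdivrMr//; apply: lb_le_inf; first exact: cover_densities_nonempty.
move=> _ [s [x [s0 cx ->]]].
have x0 := covers_ge0 cx.
rewrite ler_pdivrMr//; apply: ler_gt1P.
  by rewrite mulr_ge0 ?(ltW P0)// divr_ge0// exprn_ge0// ltW.
move=> q q1; have [L0 L00 /(_ L0 (lexx _))] := congr_cover_large At Au s0 q1 cx.
move=> /(covering_constant_le L00) /le_trans; apply.
by rewrite mulfK ?gt_eqF ?exprn_gt0// [leRHS]mulrA.
Qed.

Lemma upper_trig1 : upper_trig (1%:M : 'M[R]_n).
Proof.
by split=> [i j ij|i]; rewrite mxE ?eqxx ?ltr01// -val_eqE /= gtn_eqF.
Qed.

Lemma covering_constant_covers_large H q : 0 < covering_constant H -> 1 < q ->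
  exists2 L0 : R, 0 < L0 & forall L, L0 <= L ->
    covers (ball_rel H 1) (cube 0 L) (q * covering_constant H * L ^+ n).
Proof.
move=> k0 q1.
(* One factor [tau] pays for a near-optimal cube, the other for replicating it. *)
have [tau tau1 tauq] := exp_root_gt1 2 q1.
have hi : has_inf (cover_densities H).
  by split; [exact: cover_densities_nonempty|exists 0 => ? /cover_densities_ge0].
have e0 : 0 < (tau - 1) * covering_constant H by rewrite mulr_gt0// subr_gt0.
have [_ [s [x [s0 cx ->]]] hx] := inf_adherent e0 hi.
have [L0 L00 hL] := congr_cover_large upper_trig1 (unitmx1 _ _) s0 tau1 cx.
exists L0 => // L hLL; have := hL L hLL; rewrite mul1mx trmx1 mulmx1.
rewrite big1 ?mulr1; last by move=> i _; rewrite mxE eqxx.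
move=> /covers_sub; apply => //.
rewrite ler_wpM2r//.
  by rewrite exprn_ge0// (le_trans _ hLL)// ltW.
apply: (@le_trans _ _ (tau * (tau * covering_constant H))).
  rewrite ler_wpM2l ?(le_trans _ (ltW tau1))//.
  by apply/ltW/(lt_le_trans hx); rewrite -/(covering_constant H); lra.
by rewrite mulrA -expr2 ler_wpM2r// ltW.
Qed.

(* A unit ball contains at most one point of the grid of step 3. *)
Lemma covering_constant1_gt0 : 0 < covering_constant 1%:M.
Proof.
apply: (@lt_le_trans _ _ (3^-1 ^+ n)); first by rewrite exprn_gt0.
apply: lb_le_inf; first exact: cover_densities_nonempty.
move=> _ [L [x [L0 [z [zx hz]] ->]]].
rewrite ler_pdivlMr ?exprn_gt0// -exprMn; apply: le_trans zx.
pose M := (Num.truncn (L / 3)).+1.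
pose g (f : {ffun 'I_n -> 'I_M}) : 'rV[R]_n := \row_i (3 * (f i)%:R).
have gL f : cube 0 L (g f).
  move=> i; rewrite !mxE add0r mulr_ge0//= mulrC -ler_pdivlMr//.
  by rewrite -truncn_ge_nat ?divr_ge0 ?(ltW L0)// -ltnS ltn_ord.
have cP f : exists c, (c \in z) && `[< ball_rel 1%:M 1 (g f) c >].
  by have [c cz hc] := hz _ (gL f); exists c; rewrite cz; apply/asboolP.
pose c f := xchoose (cP f).
have cin f : c f \in z by have /andP[] := xchooseP (cP f).
have cb f i : `|g f ord0 i - c f ord0 i| <= 1.
  have /andP[_ /asboolP] := xchooseP (cP f).
  rewrite /ball_rel qform1 /sqnorm /dotv => h.
  rewrite -(ler_pXn2r (n := 2)) ?nnegrE// (le_trans _ h)//.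
  rewrite (bigD1 i)//= !mxE -expr2 real_normK ?num_real// lerDl sumr_ge0// => j _.
  by rewrite -expr2 sqr_ge0.
have cinj : injective c.
  move=> f f' cff'; apply/ffunP => i; apply/val_inj => /=.
  have h1 := cb f i; have h2 := cb f' i; rewrite -cff' in h2.
  move: h1 h2; rewrite !mxE; move: (f i : nat) (f' i : nat) (c f ord0 i) => k k' w.
  rewrite !ler_norml => /andP[h1 h2] /andP[h3 h4].
  have h5 : (k%:R : R) < k'%:R + 1 by clear -h1 h2 h3 h4; lra.
  have h6 : (k'%:R : R) < k%:R + 1 by clear -h1 h2 h3 h4; lra.
  rewrite natr1 ltr_nat ltnS in h5; rewrite natr1 ltr_nat ltnS in h6.
  by apply/eqP; rewrite eqn_leq h5.
have : (#|{ffun 'I_n -> 'I_M}| <= size z)%N.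
  rewrite cardE -(size_map c); apply: uniq_leq_size.
    by rewrite map_inj_uniq// enum_uniq.
  by move=> _ /mapP[f _ ->].
rewrite card_ffun !card_ord -(ler_nat R) natrX; apply: le_trans.
rewrite lerXn2r ?nnegrE//.
  by rewrite mulrC divr_ge0// ltW.
by rewrite mulrC ltW// truncnS_gt.
Qed.

End covering_constant.

(** * Cholesky factorisation and the role of the determinant *)

Section determinant.
Context {R : realType}.

Definition posdef n (H : 'M[R]_n) : Prop :=
  H^T = H /\ forall v : 'rV[R]_n, v != 0 -> 0 < qform H v.

(** Induction on the first row and column: [[[a, u], [0, A]]] is a factor of [[[h, b], [b^T, C]]]
    when [A A^T = C], [u A^T = b] and [a ^ 2 = h - u u^T]. The inverse is built alongside, because
    its triangularity gives the reverse bound in [covering_constant_det]. *)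
Lemma cholesky n (H : 'M[R]_n) : posdef H ->
  exists A B : 'M[R]_n,
    [/\ upper_trig A, upper_trig B, A *m B = 1%:M & A *m A^T = H].
Proof.
elim: n H => [|n IH] H [Hs Hp].
  exists 0, 0; split; try by split=> [] [].
  - by apply/matrixP => -[].
  - by apply/matrixP => -[].
pose H1 : 'M[R]_(1 + n) := H.
pose h := @ulsubmx R 1 n 1 n H1; pose b := @ursubmx R 1 n 1 n H1.
pose C := @drsubmx R 1 n 1 n H1.
have HE : H1 = block_mx h b b^T C.
  rewrite -[LHS]submxK; congr block_mx.
  by rewrite trmx_ursub -[in RHS]/(H^T) Hs.
have Cs : C^T = C by rewrite trmx_drsub -[in LHS]/(H^T) Hs.
have qb (x : 'M[R]_1) (w : 'rV[R]_n) : qform H (row_mx x w : 'rV[R]_(1 + n)) =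
    (x *m h *m x^T + w *m b^T *m x^T + (x *m b *m w^T + w *m C *m w^T)) ord0 ord0.
  rewrite /qform -[H]/H1 HE (@mul_row_block R 1 1 n 1 n) (@tr_row_mx R 1 1 n).
  by rewrite (@mul_row_col R 1 1 n 1) !mulmxDl.
have [|A [B [[A0 Ap] [B0 Bp] AB AA]]] := IH C.
  split=> // w w0.
  have := Hp (row_mx (0 : 'M[R]_1) w : 'rV[R]_(1 + n)).
  rewrite qb !mul0mx trmx0 !mulmx0 !add0r; apply.
  apply: contra w0 => /eqP; rewrite -(@row_mx0 R 1 1 n) => E.
  by have [_ ->] := @eq_row_mx R 1 1 n _ _ _ _ E.
have BA : B *m A = 1%:M by exact: mulmx1C.
pose u : 'rV[R]_n := b *m B^T.
have bE : b = u *m A^T by rewrite /u -mulmxA -trmx_mul AB trmx1 mulmx1.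
pose w := u *m B.
have e1 : w *m b^T = u *m u^T by rewrite bE trmx_mul trmxK mulmxA -(mulmxA u) BA mulmx1.
have e2 : b *m w^T = u *m u^T by rewrite -[LHS]trmxK trmx_mul trmxK e1 trmx_mul trmxK.
have e3 : w *m C *m w^T = u *m u^T.
  by rewrite -AA (mulmxA w) /w -(mulmxA u) BA mulmx1 -bE e2.
(* This Schur complement is the value of the form at [(1, - b C^-1)]; indeed [w = b C^-1], as
   [C^-1 = B^T B]. *)
have hp : 0 < (h - u *m u^T) ord0 ord0.
  have := Hp (row_mx (1%:M : 'M[R]_1) (- w) : 'rV[R]_(1 + n)).
  rewrite qb trmx1 !mulmx1 !mul1mx linearN /= !mulNmx !mulmxN opprK e1 e2 e3.
  rewrite addNr addr0; apply.
  apply/eqP => /(congr1 (fun M : 'rV[R]_(1 + n) => M ord0 (lshift n ord0))).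
  rewrite (@row_mxEl R 1 1 n) !mxE eqxx => /eqP.
  by rewrite oner_eq0.
pose a := Num.sqrt ((h - u *m u^T) ord0 ord0).
have a0 : 0 < a by rewrite sqrtr_gt0.
exists (block_mx (a%:M : 'M[R]_1) u 0 A : 'M[R]_(1 + n)).
exists (block_mx (a^-1%:M : 'M[R]_1) (- (a^-1 *: (u *m B))) 0 B : 'M[R]_(1 + n)).
have trig (x : R) r (D : 'M[R]_n) : 0 < x ->
    (forall i j : 'I_n, (j < i)%N -> D i j = 0) -> (forall i, 0 < D i i) ->
    upper_trig (block_mx (x%:M : 'M[R]_1) r 0 D : 'M[R]_(1 + n)).
  move=> x0 D0 Dp; split.
    move=> i j; case: (@split_ordP 1 n i) => i' ->; case: (@split_ordP 1 n j) => j' -> /=.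
    - by rewrite !ord1.
    - by rewrite !ord1 /=.
    - by move=> _; rewrite (@block_mxEdl R 1 n 1 n) mxE.
    - by rewrite (@block_mxEdr R 1 n 1 n) ltn_add2l; exact: D0.
  move=> i; case: (@split_ordP 1 n i) => i' ->.
    by rewrite (@block_mxEul R 1 n 1 n) mxE eqxx.
  by rewrite (@block_mxEdr R 1 n 1 n).
split.
- exact: trig.
- by apply: trig; rewrite ?invr_gt0.
- rewrite (@mulmx_block R 1 n 1 n 1 n) !mulmx0 !mul0mx !addr0 !add0r AB.
  rewrite -scalar_mxM mulfV ?gt_eqF// mul_scalar_mx scalerN scalerA mulfV ?gt_eqF//.
  by rewrite scale1r addNr -scalar_mx_block.
- rewrite (@tr_block_mx R 1 n 1 n) (@mulmx_block R 1 n 1 n 1 n).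
  rewrite !trmx0 !mulmx0 !mul0mx !add0r tr_scalar_mx -bE AA -[RHS]/H1 HE.
  have -> : a%:M *m a%:M + u *m u^T = h.
    rewrite -scalar_mxM -expr2 sqr_sqrtr ?(ltW hp)//.
    by apply/matrixP => i j; rewrite !ord1 !mxE eqxx mulr1n; ring.
  have <- : b^T = A *m u^T by rewrite {1}bE trmx_mul trmxK.
  by [].
Qed.

Lemma upper_trig_det n (A : 'M[R]_n) : upper_trig A ->
  \det A = \prod_(i < n) A i i.
Proof.
move=> [A0 _]; rewrite -det_tr det_trig; last first.
  by apply/is_trig_mxP => i j ij; rewrite mxE A0.
by apply: eq_bigr => i _; rewrite mxE.
Qed.

(** With [H = A A^T], congruence of the identity by [A] gives one inequality, and congruence of [H]
    by [B = A^-1], which returns the identity, gives the other. *)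
Lemma covering_constant_det n (H : 'M[R]_n) : posdef H ->
  covering_constant H = covering_constant (1%:M : 'M[R]_n) * Num.sqrt (\det H).
Proof.
move=> /cholesky[A [B [At Bt AB AA]]].
have [Au Bu] := mulmx1_unit AB.
have P0 : 0 < \prod_(i < n) A i i by apply: prodr_gt0 => i _; case: At.
have Q0 : 0 < \prod_(i < n) B i i by apply: prodr_gt0 => i _; case: Bt.
have PQ : (\prod_(i < n) A i i) * (\prod_(i < n) B i i) = 1.
  by rewrite -!upper_trig_det// -det_mulmx AB det1.
have -> : Num.sqrt (\det H) = \prod_(i < n) A i i.
  rewrite -AA det_mulmx det_tr upper_trig_det// -expr2 sqrtr_sqr.
  by rewrite gtr0_norm.
apply/eqP; rewrite eq_le; apply/andP; split.
  by have := @covering_constant_congr_le _ _ A 1%:M At Au; rewrite mulmx1 AA.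
have := @covering_constant_congr_le _ _ B H Bt Bu.
have -> : B *m H *m B^T = 1%:M.
  rewrite -AA !mulmxA (mulmx1C AB) mul1mx -trmx_mul (mulmx1C AB).
  by rewrite trmx1.
by rewrite -(ler_pM2r P0) -mulrA (mulrC (\prod_(i < n) B i i)) PQ mulr1.
Qed.

(** A unit ball of [H] lies in the ball of [H'] of radius [mu] with the same centre; rescaling to
    radius 1 costs [mu ^+ n]. *)
Lemma covering_constant_mono n (H H' : 'M[R]_n) (mu : R) : 0 < mu ->
  (forall v, qform H' v <= mu ^+ 2 * qform H v) ->
  covering_constant H' <= mu ^+ n * covering_constant H.
Proof.
move=> mu0 hH; rewrite -ler_pdivrMl ?exprn_gt0//.
apply: lb_le_inf; first exact: cover_densities_nonempty.
move=> _ [L [x [L0 cx ->]]].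
have /(covering_constant_cover mu0 L0) : covers (ball_rel H' mu) (cube 0 L) x.
  apply: covers_sub cx _ _ (lexx _) => // y c _; rewrite /ball_rel => hc.
  by rewrite (le_trans (hH _))// -[leRHS]mulr1 ler_pM2l ?exprn_gt0// -(expr1n _ 2).
rewrite expr_div_n mulrA ler_pdivrMr ?exprn_gt0// => hx.
by rewrite ler_pdivlMr ?exprn_gt0// -mulrA ler_pdivrMl ?exprn_gt0// [leRHS]mulrC.
Qed.

End determinant.

(** * Grids in a convex body *)

Section sandwich.
Context {R : realType} {n : nat}.
Lemma convex_setP (A : set 'rV[R]_n) x y (k : R) : convex_set A -> A x -> A y -> 0 <= k <= 1 ->
  A (k *: x + (1 - k) *: y).
Proof.
move=> cA Ax Ay /andP[k0 k1].
have /(_ (Itv01 k0 k1)) := cA x y _ (mem_set Ax) (mem_set Ay).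
by move/set_mem.
Qed.
Lemma rV_norm_le (v : 'rV[R]_n) (e : R) : 0 <= e -> (`|v| <= e) <-> forall i, `|v ord0 i| <= e.
Proof.
move=> e0; rewrite /Num.norm /= mx_normrE; split.
  move=> h i; apply: le_trans h.
  exact: (@le_bigmax _ _ _ _ (fun ij => `|v ij.1 ij.2|) (ord0, i)).
move=> h; apply/bigmax_leP; split=> // -[i j] _ /=; rewrite ord1; exact: h.
Qed.

Implicit Types (a c y : 'rV[R]_n) (Y : set 'rV[R]_n).

(** Half-open, so that grid cells are disjoint and floors locate a point in its cell; coverings use
    the closed [cube]. *)
Definition hcube a (h : R) : set 'rV[R]_n :=
  [set y | forall i, a ord0 i <= y ord0 i < a ord0 i + h].

Lemma measurable_hcube a h : measurable (hcube a h).
Proof.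
rewrite (_ : hcube a h = \bigcap_(i in [set: 'I_n])
    ((fun x : 'rV[R]_n => x ord0 i : measurableTypeR R)
      @^-1` `[a ord0 i, a ord0 i + h[%classic)).
  apply: fin_bigcap_measurable => // i _.
  by rewrite -[X in measurable X]setTI; exact: measurable_rV_coord.
apply/seteqP; split=> [y hy i _|y hy i] /=.
  by rewrite in_itv /=; exact: hy.
by have := hy i I; rewrite /= in_itv.
Qed.

Lemma lebesgue_hcube a h : 0 < h -> lebesgue_rV n (hcube a h) = (h ^+ n)%:E.
Proof.
move=> h0.
have -> : hcube a h = [set x : 'rV[R]_n |
    forall i, (`[a ord0 i, a ord0 i + h[%classic : set (measurableTypeR R)) (x ord0 i)].
  by apply/seteqP; split=> y hy i; have := hy i; rewrite /= in_itv.
rewrite (lebesgue_rV_box (A := fun i => `[a ord0 i, a ord0 i + h[%classic))//.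
rewrite (eq_bigr (fun=> h%:E)); last first.
  move=> i _; rewrite lebesgue_measure_itv /= lte_fin ltrDl h0 -EFinB.
  by rewrite addrAC subrr add0r.
by rewrite prodEFin prodr_const card_ord.
Qed.

(* No measurability is required: the integral is a supremum over simple functions. *)
Lemma le_integral_restrict (mu : {measure set 'rV[R]_n -> \bar R})
    (D D' : set 'rV[R]_n) (f g : 'rV[R]_n -> \bar R) :
  (forall x, D x -> 0 <= f x)%E -> (forall x, D' x -> 0 <= g x)%E ->
  (forall x, (f \_ D) x <= (g \_ D') x)%E ->
  (\int[mu]_(x in D) f x <= \int[mu]_(x in D') g x)%E.
Proof.
move=> f0 g0 fg; rewrite ge0_integralE// [leRHS]ge0_integralE//.
by apply: ereal_sup_le => _ [h hf <-]; exists h => // x; exact: le_trans (fg x).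
Qed.

(** [Num.max 0] makes the integrand nonnegative everywhere although [G] is controlled only on [s].
    The corner map [b] is there for the inflated, overlapping cells of the upper bound. *)
Lemma integral_hcubes (s : seq 'rV[R]_n) (b : 'rV[R]_n -> 'rV[R]_n)
    (G : 'rV[R]_n -> R) h : 0 < h -> (forall a, a \in s -> 0 <= G a) ->
  (\int[lebesgue_rV n]_(y in setT)
     (\sum_(a <- s) Num.max 0 (G a) * \1_(hcube (b a) h) y)%:E)%E =
  (\sum_(a <- s) G a * h ^+ n)%:E.
Proof.
move=> h0 G0; under eq_integral do rewrite -sumEFin.
rewrite ge0_integral_sum//; last 2 first.
- move=> a; apply/measurable_EFinP; apply: measurable_funM => //.
  by apply: measurable_indic; exact: measurable_hcube.
- by move=> a y _; rewrite lee_fin mulr_ge0// le_max lexx.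
rewrite -sumEFin big_seq [RHS]big_seq; apply: eq_bigr => a /G0 Ga.
under eq_integral do rewrite EFinM.
rewrite ge0_integralZl//; last 2 first.
- by apply/measurable_EFinP; apply: measurable_indic; exact: measurable_hcube.
- by rewrite lee_fin le_max lexx.
rewrite integral_indic//; last exact: (measurable_hcube (b a) h).
by rewrite setIT max_r// EFinM; congr (_ * _)%E; exact: lebesgue_hcube.
Qed.

Lemma integral_ge_hcubes (s : seq 'rV[R]_n) Y (g G : 'rV[R]_n -> R) h :
  0 < h -> uniq s -> (forall a, a \in s -> 0 <= G a) ->
  (forall y, Y y -> 0 <= g y) ->
  (forall a a' y, a \in s -> a' \in s -> hcube a h y -> hcube a' h y -> a = a') ->
  (forall a y, a \in s -> hcube a h y -> Y y /\ G a <= g y) ->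
  ((\sum_(a <- s) G a * h ^+ n)%:E <= \int[lebesgue_rV n]_(y in Y) (g y)%:E)%E.
Proof.
move=> h0 us G0 g0 sd sY.
rewrite -(@integral_hcubes s id)//; apply: le_integral_restrict => [y _|//|y].
  rewrite lee_fin sumr_ge0// => a _.
  by rewrite mulr_ge0// le_max lexx.
rewrite patchE in_setT /=.
have [[a [sa ay]]|ns] := pselect (exists a, a \in s /\ hcube a h y).
  have [Yy Gg] := sY a y sa ay.
  rewrite patchE mem_set// lee_fin (bigD1_seq a)//= big_seq_cond big1 ?addr0.
    by rewrite indicE mem_set// mulr1 max_r ?G0.
  move=> a' /andP[a's a'a]; rewrite indicE memNset ?mulr0// => a'y.
  by move/negP: a'a; apply; apply/eqP; exact: (sd _ _ y).
rewrite big_seq big1.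
  by rewrite patchE; case: ifPn => // /set_mem /g0; rewrite lee_fin.
move=> a sa; rewrite indicE memNset ?mulr0// => ay.
by apply: ns; exists a.
Qed.

Lemma integral_le_hcubes (s : seq 'rV[R]_n) (b : 'rV[R]_n -> 'rV[R]_n) Y
    (g G : 'rV[R]_n -> R) h :
  0 < h -> (forall a, a \in s -> 0 <= G a) ->
  (forall y, Y y -> 0 <= g y) ->
  (forall y, Y y -> exists2 a, a \in s & hcube (b a) h y /\ g y <= G a) ->
  (\int[lebesgue_rV n]_(y in Y) (g y)%:E <= (\sum_(a <- s) G a * h ^+ n)%:E)%E.
Proof.
move=> h0 G0 g0 sY.
rewrite -(@integral_hcubes s b)//; apply: le_integral_restrict => [//|y _|y].
  rewrite lee_fin sumr_ge0// => a _.
  by rewrite mulr_ge0// le_max lexx.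
have S0 (r : seq 'rV[R]_n) : 0 <= \sum_(a <- r) Num.max 0 (G a) * \1_(hcube (b a) h) y.
  by rewrite sumr_ge0// => a _; rewrite mulr_ge0// le_max lexx.
rewrite [X in (_ <= X)%E]patchE in_setT patchE; case: ifPn => [/set_mem Yy|_]; last first.
  by rewrite lee_fin.
have [a sa [ay ga]] := sY y Yy; rewrite lee_fin.
rewrite (perm_big _ (perm_to_rem sa)) big_cons /= indicE mem_set// mulr1.
by rewrite (le_trans ga)// -[leLHS]addr0 lerD// le_max lexx orbT.
Qed.

(** Let [Y'] be [Y] contracted towards [c] by [lambda^-1]. By convexity the box of half-side
    [(1 - lambda^-1) * rho] about any point of [Y'] lies in [Y], hence so does every cell of side
    [h] meeting [Y']; these cells form the grid. *)
Lemma convex_grid Y c (rho B lambda h : R) :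
  convex_set Y -> (forall y, (forall i, `|y ord0 i - c ord0 i| <= rho) -> Y y) ->
  (forall y i, Y y -> `|y ord0 i| <= B) ->
  0 < rho -> 1 < lambda -> 0 < h -> h <= (1 - lambda^-1) * rho ->
  exists s : seq 'rV[R]_n, [/\ uniq s,
    forall a, a \in s -> cube a h `<=` Y,
    forall a a' y, a \in s -> a' \in s -> hcube a h y -> hcube a' h y -> a = a' &
    forall y, Y y -> exists2 a, a \in s & hcube a h (c + lambda^-1 *: (y - c))].
Proof.
move=> cY rY BY rho0 lam1 h0 hrho.
have lam0 : 0 < lambda by exact: lt_trans lam1.
have l1 : 0 < lambda^-1 < 1 by rewrite invr_gt0 lam0 invf_lt1.
have [l0' l1'] := andP l1.
pose Y' y := exists2 y0, Y y0 & y = c + lambda^-1 *: (y0 - c).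
have Yc : Y c by apply: rY => i; rewrite subrr normr0 ltW.
have Y'Y y : Y' y -> Y y.
  move=> [y0 Yy0 ->]; have -> : c + lambda^-1 *: (y0 - c) =
      lambda^-1 *: y0 + (1 - lambda^-1) *: c.
    by apply/rowP => i; rewrite !mxE; ring.
  by apply: convex_setP => //; rewrite !ltW.
have Y'n y (z : 'rV[R]_n) : Y' y -> (forall i, `|z ord0 i - y ord0 i| <= h) -> Y z.
  move=> [y0 Yy0 ->] hz; have -> : z = lambda^-1 *: y0 + (1 - lambda^-1) *:
      (c + (1 - lambda^-1)^-1 *: (z - (c + lambda^-1 *: (y0 - c)))).
    by apply/rowP => i; rewrite !mxE; field; rewrite gt_eqF//= gt_eqF// subr_gt0.
  apply: convex_setP => //; last by rewrite !ltW.
  apply: rY => i; have := hz i; rewrite !mxE => hzi.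
  rewrite addrAC subrr add0r normrM gtr0_norm ?invr_gt0 ?subr_gt0//.
  by rewrite ler_pdivrMl ?subr_gt0//; exact: le_trans hrho.
pose g (m : {ffun 'I_n -> int}) : 'rV[R]_n := \row_i (h * (m i)%:~R).
(* Coordinates of points of [Y'] are bounded by [B]; the floor may lose 1, on the lower side
   only. *)
have [|ms [_ msP]] := @int_box R n (fun=> - (B / h) - 1) (fun=> 2 * (B / h) + 1).
  by move=> i; rewrite addr_ge0// mulr_ge0// divr_ge0 ?(ltW h0)// (le_trans _ (BY c i Yc)).
have fl (m : {ffun 'I_n -> int}) y : hcube (g m) h y ->
    forall i, m i = Num.floor (y ord0 i / h).
  move=> my i; have := my i; rewrite !mxE => /andP[m1 m2].
  apply/esym/floor_def; rewrite intrD ler_pdivlMr// ltr_pdivrMr// mulrDl mul1r.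
  by rewrite !(mulrC _ h) m1 m2.
exists (undup [seq g m | m <- ms & `[< exists2 y, Y' y & hcube (g m) h y >]]).
split; first exact: undup_uniq.
- move=> a; rewrite mem_undup => /mapP[m]; rewrite mem_filter => /andP[/asboolP[y Yy my] _ ->].
  move=> z mz; apply: (Y'n y) => // i.
  have /andP[h1 h2] := my i; have /andP[h3 h4] := mz i.
  by rewrite ler_norml; apply/andP; split; lra.
- move=> a a' y; rewrite !mem_undup => /mapP[m _ ->] /mapP[m' _ ->] /fl my /fl m'y.
  by congr g; apply/ffunP => i; rewrite my m'y.
- move=> y Yy; set y' := c + _; have Yy' : Y' y' by exists y.
  pose m : {ffun 'I_n -> int} := [ffun i => Num.floor (y' ord0 i / h)].
  have my' : hcube (g m) h y'.
    move=> i; rewrite [g m ord0 i]mxE ffunE; set q := y' ord0 i / h.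
    have -> : y' ord0 i = h * q by rewrite mulrC divfK// gt_eqF.
    rewrite -[X in _ < _ + X]mulr1 -mulrDr ler_pM2l// ltr_pM2l// floor_le /=.
    by have := floorD1_gt q; rewrite intrD.
  exists (g m) => //; rewrite mem_undup; apply/map_f; rewrite mem_filter.
  apply/andP; split; first by apply/asboolP; exists y'.
  apply: msP => i; rewrite ffunE.
  have f1 := floor_le (y' ord0 i / h); have := floorD1_gt (y' ord0 i / h).
  rewrite intrD => f2.
  have : `|y' ord0 i / h| <= B / h.
    have h'0 : 0 < h^-1 by rewrite invr_gt0.
    by rewrite normrM (gtr0_norm h'0) ler_pM2r//; exact/BY/Y'Y.
  by rewrite ler_norml => /andP[n1 n2]; apply/andP; split; lra.
Qed.

End sandwich.

(** * Asymptotics of coverings by Bregman balls *)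

Section asymptotics.
Context {R : realType} {n : nat}.
Implicit Types (a c x y z v : 'rV[R]_n).

(** The grid is fixed before [r] shrinks, so only finitely many thresholds have to be combined. *)
Lemma eventually_all_seq (T : eqType) (s : seq T) (P : T -> R -> Prop) :
  (forall t, t \in s -> exists2 r0 : R, 0 < r0 & forall r, 0 < r < r0 -> P t r) ->
  exists2 r0 : R, 0 < r0 & forall r, 0 < r < r0 -> forall t, t \in s -> P t r.
Proof.
elim: s => [|t s IH] hs; first by exists 1.
have [r1 r10 h1] := hs t (mem_head _ _).
have [|r2 r20 h2] := IH.
  by move=> b bs; apply: hs; rewrite in_cons bs orbT.
exists (Num.min r1 r2); first by rewrite lt_min r10.
move=> r /andP[r0]; rewrite lt_min => /andP[rr1 rr2] b.
rewrite in_cons => /predU1P[->|bs]; first by apply: h1; rewrite r0.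
by apply: h2; rewrite ?r0.
Qed.


Lemma sum_count_disjoint (s z : seq 'rV[R]_n) (P : 'rV[R]_n -> pred 'rV[R]_n) :
  uniq s ->
  (forall a a' c, a \in s -> a' \in s -> P a c -> P a' c -> a = a') ->
  (\sum_(a <- s) count (P a) z <= size z)%N.
Proof.
move=> us sd; elim: z => [|c z IH] /=; first by rewrite big1.
rewrite big_split /= -[(size z).+1]add1n leq_add//.
have [/hasP[a0 a0s Pa0]|/hasPn ns] := boolP (has (fun a => P a c) s); last first.
  by rewrite big_seq big1// => a /ns /negPf ->.
rewrite (perm_big _ (perm_to_rem a0s)) big_cons /= Pa0 big_seq big1// => a.
rewrite mem_rem_uniq// inE => /andP[aa0 sa]; case: (boolP (P a c)) => // Pa.
by move: aa0; rewrite (sd _ _ _ sa a0s Pa Pa0) eqxx.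
Qed.

Definition coord_dist_le (x y : 'rV[R]_n) (e : R) := forall i, `|x ord0 i - y ord0 i| <= e.

(** A factor [mu ^+ 2] on forms is a factor [mu] on radii. [rho] is uniform in [a], so one mesh
    serves the whole grid, and [x], [y], [z] may leave [Y], as centres of balls do. *)
Definition locally_quadratic (Hs : 'rV[R]_n -> 'M[R]_n)
    (D : 'rV[R]_n -> 'rV[R]_n -> R) (Y : set 'rV[R]_n) : Prop :=
  forall mu : R, 1 < mu -> exists2 rho : R, 0 < rho & forall a, Y a ->
    (forall x, coord_dist_le x a rho -> forall v,
        qform (Hs x) v <= mu ^+ 2 * qform (Hs a) v /\
        qform (Hs a) v <= mu ^+ 2 * qform (Hs x) v) /\
    (forall y z, coord_dist_le y a rho -> coord_dist_le z a rho ->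
        2 * D y z <= mu ^+ 2 * qform (Hs a) (y - z) /\
        qform (Hs a) (y - z) <= mu ^+ 2 * (2 * D y z)).

Lemma coord_le_sqnorm v (e m : R) : 0 < m -> 0 <= e -> m * sqnorm v <= e ^+ 2 ->
  forall i, `|v ord0 i| <= e / Num.sqrt m.
Proof.
move=> m0 e0 hv i; have sm : 0 < Num.sqrt m by rewrite sqrtr_gt0.
rewrite -(ler_pXn2r (n := 2)) ?nnegrE ?divr_ge0 ?(ltW sm)//.
rewrite expr_div_n sqr_sqrtr ?(ltW m0)// ler_pdivlMr// real_normK ?num_real// mulrC.
apply: le_trans hv; rewrite ler_pM2l// /sqnorm /dotv (bigD1 i)//= -expr2 lerDl.
by rewrite sumr_ge0// => j _; rewrite -expr2 sqr_ge0.
Qed.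


Context (Hs : 'rV[R]_n -> 'M[R]_n) (D : 'rV[R]_n -> 'rV[R]_n -> R).
Context (Y : set 'rV[R]_n) (m B rho0 : R) (p : 'rV[R]_n).
Context (m0 : 0 < m) (rho00 : 0 < rho0)
  (Hspd : forall y, posdef (Hs y))
  (Hsm : forall y v, m * sqnorm v <= qform (Hs y) v)
  (Dm : forall y z, m * sqnorm (y - z) <= 2 * D y z)
  (locq : locally_quadratic Hs D Y)
  (cY : convex_set Y) (YB : forall y i, Y y -> `|y ord0 i| <= B)
  (pY : forall y, coord_dist_le y p rho0 -> Y y).

Local Notation k1 := (covering_constant (1%:M : 'M[R]_n)).
Let g y := Num.sqrt (\det (Hs y)).
Let J := (\int[lebesgue_rV n]_(y in Y) (g y)%:E)%E.

(** Monotonicity of the determinant is read off from coverings: covering constants are monotone by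
    inclusion of balls, and they are proportional to [g]. *)
Let g_mono mu x y : 0 < mu ->
  (forall v, qform (Hs x) v <= mu ^+ 2 * qform (Hs y) v) -> g x <= mu ^+ n * g y.
Proof.
move=> mu0 /(covering_constant_mono mu0).
rewrite (covering_constant_det (Hspd x)) (covering_constant_det (Hspd y)) mulrCA ler_pM2l//.
exact: covering_constant1_gt0.
Qed.

Let pY' : Y p.
Proof. by apply: pY => i; rewrite subrr normr0 ltW. Qed.

(* The cubes meeting a slightly shrunk copy of [Y] lie inside [Y], and undoing the
   shrinking makes them cover [Y]; this avoids proving that the boundary of [Y] is
   negligible. *)
Let fine_grid (mu : R) : 1 < mu ->
  exists (s : seq 'rV[R]_n) (lam h rho : R),
    [/\ 0 < h, 1 < lam <= mu, 0 < rho & uniq s] /\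
    [/\ forall a a' y, a \in s -> a' \in s -> hcube a h y -> hcube a' h y -> a = a',
      forall a, a \in s -> hcube a h `<=` Y,
      forall y, Y y -> exists2 a, a \in s &
        hcube (p + lam *: (a - p)) (lam * h) y /\ coord_dist_le y a rho,
      forall a y, a \in s -> hcube a h y -> coord_dist_le y a rho &
      forall a, a \in s ->
        (forall x, coord_dist_le x a (2 * rho) -> g x <= mu ^+ n * g a /\
          g a <= mu ^+ n * g x) /\
        (forall y z, coord_dist_le y a (2 * rho) -> coord_dist_le z a (2 * rho) ->
          2 * D y z <= mu ^+ 2 * qform (Hs a) (y - z) /\
          qform (Hs a) (y - z) <= mu ^+ 2 * (2 * D y z))].
Proof.
move=> mu1; have mu0 : 0 < mu by exact: lt_trans mu1.
have [rho2 rho20 hrho] := locq mu1.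
(* Halved because the centre of a ball may lie [rho] further from the corner than the point of the
   cell that it covers. *)
pose rho := rho2 / 2; have rho_gt0 : 0 < rho by rewrite divr_gt0.
have rhoE : 2 * rho = rho2 by rewrite /rho; field.
have B1 : 0 < `|B| + 1 by rewrite ltr_wpDl.
(* Undoing the contraction moves a point of [Y] by at most [(lam - 1) * 2 (|B| + 1) <= rho / 2] per
   coordinate; as [h <= rho / 2], it ends within [rho] of the corner. *)
pose lam := Num.min mu (1 + rho / (4 * (`|B| + 1))).
have lam1 : 1 < lam by rewrite lt_min mu1 ltrDl divr_gt0// mulr_gt0.
have lam0 : 0 < lam by exact: lt_trans lam1.
pose h := Num.min (rho / 2) ((1 - lam^-1) * rho0).
have l1 : 0 < lam^-1 < 1 by rewrite invr_gt0 lam0 invf_lt1.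
have [l0' l1'] := andP l1.
have h0 : 0 < h by rewrite lt_min divr_gt0//= mulr_gt0// subr_gt0.
have hrho0 : h <= (1 - lam^-1) * rho0 by rewrite ge_min lexx orbT.
have [s [us sY sd sc]] := convex_grid cY pY YB rho00 lam1 h0 hrho0.
have aY a : a \in s -> Y a.
  by move=> sa; apply: (sY a sa) => i; rewrite lexx lerDl ltW.
have hc a y : hcube a h y -> cube a h y.
  by move=> hy i; have /andP[-> /ltW] := hy i.
have hr : h <= rho / 2 by rewrite ge_min lexx.
exists s, lam, h, rho; split; first by rewrite lam1 ge_min lexx.
split=> //.
- by move=> a sa y /hc; exact: sY.
- move=> y Yy; have [a sa ay] := sc y Yy; exists a => //; split=> i.
    have /andP[a1 a2] := ay i; rewrite !mxE in a1 a2 *.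
    set q := lam^-1 * (y ord0 i - p ord0 i) in a1 a2.
    have yE : y ord0 i = p ord0 i + lam * q by rewrite /q; field; rewrite gt_eqF.
    have q1 : lam * (a ord0 i - p ord0 i) <= lam * q by rewrite ler_pM2l//; lra.
    have q2 : lam * q < lam * (a ord0 i - p ord0 i + h) by rewrite ltr_pM2l//; lra.
    by rewrite yE; apply/andP; split; lra.
  have /andP[a1 a2] := ay i; rewrite !mxE in a1 a2.
  have Bi x : Y x -> `|x ord0 i| <= `|B| + 1.
    by move=> /(YB i) /le_trans; apply; rewrite (le_trans (ler_norm B))// lerDl.
  have y1 := Bi y Yy; have p1 := Bi p pY'.
  set w := y ord0 i - p ord0 i in a1 a2.
  have w1 : `|w| <= 2 * (`|B| + 1).
    by rewrite (le_trans (ler_normB _ _))// mulr_natl mulr2n lerD.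
  have : `|(1 - lam^-1) * w| <= rho / 2.
    rewrite normrM gtr0_norm ?subr_gt0//.
    have : 1 - lam^-1 <= rho / (4 * (`|B| + 1)).
      apply: (@le_trans _ _ (lam - 1)).
        have -> : 1 - lam^-1 = (lam - 1) / lam by field; rewrite gt_eqF.
        by rewrite ler_pdivrMr// ler_peMr ?subr_ge0 ?ltW.
      by rewrite lerBlDl ge_min lexx orbT.
    move=> hl; apply: (@le_trans _ _ (rho / (4 * (`|B| + 1)) * (2 * (`|B| + 1)))).
      by rewrite ler_pM// subr_ge0 ltW.
    have -> // : rho / (4 * (`|B| + 1)) * (2 * (`|B| + 1)) = rho / 2.
    by field; rewrite gt_eqF.
  rewrite !ler_norml => /andP[w2 w3].
  have yE : y ord0 i = p ord0 i + lam^-1 * w + (1 - lam^-1) * w by rewrite /w; ring.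
  by rewrite yE; apply/andP; split; lra.
- move=> a y _ hy i; have /andP[y1 y2] := hy i; rewrite ler_norml.
  by apply/andP; split; lra.
- move=> a sa; have [h1 h2] := hrho a (aY a sa); rewrite rhoE; split=> // x /h1 hx.
  by split; apply: g_mono => // v; have [] := hx v.
Qed.


Let g_gt0 y : 0 < g y.
Proof.
have /covering_constant_det E := Hspd y; have [A [A' [At _ _ AA]]] := cholesky (Hspd y).
rewrite /g sqrtr_gt0 -AA det_mulmx det_tr upper_trig_det// -expr2 exprn_gt0//.
by apply: prodr_gt0 => i _; case: At.
Qed.

(** Disjoint cells inside [Y] bound the sum by the integral, inflated cells covering [Y] bound the
    integral by the sum. Both lose [mu ^+ n] for the variation of [g] near a corner; the second also
    loses [lam ^+ n <= mu ^+ n] in volume. *)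
Let grid_integral (s : seq 'rV[R]_n) (mu lam h rho : R) :
  1 < mu -> 0 < h -> 1 < lam <= mu -> 0 < rho -> uniq s ->
  (forall a a' y, a \in s -> a' \in s -> hcube a h y -> hcube a' h y -> a = a') ->
  (forall a, a \in s -> hcube a h `<=` Y) ->
  (forall y, Y y -> exists2 a, a \in s &
    hcube (p + lam *: (a - p)) (lam * h) y /\ coord_dist_le y a rho) ->
  (forall a y, a \in s -> hcube a h y -> coord_dist_le y a rho) ->
  (forall a, a \in s -> forall x, coord_dist_le x a (2 * rho) ->
    g x <= mu ^+ n * g a /\ g a <= mu ^+ n * g x) ->
  [/\ J = (fine J)%:E, 0 < \sum_(a <- s) g a * h ^+ n,
    \sum_(a <- s) g a * h ^+ n <= mu ^+ n * fine J &
    fine J <= mu ^+ (2 * n) * \sum_(a <- s) g a * h ^+ n].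
Proof.
move=> mu1 h0 /andP[lam1 lammu] rho_gt0 us sd sY sc sr sg.
have mu0 : 0 < mu by exact: lt_trans mu1.
have lam0 : 0 < lam by exact: lt_trans lam1.
have mun : 0 < mu ^+ n by exact: exprn_gt0.
have rr y a : coord_dist_le y a rho -> coord_dist_le y a (2 * rho).
  by move=> h1 i; rewrite (le_trans (h1 i))// ler_peMl ?ler1n// ltW.
have Jl : ((\sum_(a <- s) g a / mu ^+ n * h ^+ n)%:E <= J)%E.
  apply: (integral_ge_hcubes h0 us _ _ sd) => [a _|y _|a y sa ay].
  - by rewrite divr_ge0 ?(ltW mun)// ltW.
  - exact: ltW.
  - split; first exact: sY ay.
    have [_ ga] := sg a sa y (rr _ _ (sr a y sa ay)).
    by rewrite ler_pdivrMr// mulrC.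
have Ju : (J <= (\sum_(a <- s) (mu ^+ n * g a) * (lam * h) ^+ n)%:E)%E.
  apply: (@integral_le_hcubes _ _ s (fun a => p + lam *: (a - p))) => [|a _|y _|y Yy].
  - exact: mulr_gt0.
  - by rewrite mulr_ge0 ?(ltW mun)// ltW.
  - exact: ltW.
  - have [a sa [ay yr]] := sc y Yy; exists a => //; split=> //.
    by have [] := sg a sa y (rr _ _ yr).
have JE : J = (fine J)%:E.
  rewrite fineK// fin_numElt (lt_le_trans _ Jl) ?ltNyr//=.
  by rewrite (le_lt_trans Ju)// ltry.
have S0 : 0 < \sum_(a <- s) g a * h ^+ n.
  have [a sa _] := sc p pY'; rewrite (perm_big _ (perm_to_rem sa)) big_cons /=.
  rewrite ltr_pwDl ?mulr_gt0 ?exprn_gt0// sumr_ge0// => b _.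
  by rewrite mulr_ge0 ?exprn_ge0 ?(ltW h0)// ltW.
split=> //.
- rewrite -ler_pdivrMl// -lee_fin -JE; apply: le_trans Jl; rewrite lee_fin.
  by rewrite mulr_sumr le_eqVlt; apply/orP; left; apply/eqP/eq_bigr => a _; ring.
- rewrite -lee_fin -JE; apply: (le_trans Ju); rewrite lee_fin.
  rewrite mulr_sumr; apply: ler_sum => a _.
  rewrite exprMn mulrA mulrA ler_pM2r ?exprn_gt0// mulrAC ler_pM2r// mulnC muln2 -addnn exprD.
  by rewrite ler_pM2l// lerXn2r ?nnegrE// ltW.
Qed.

Lemma integral_finite_gt0 : J = (fine J)%:E /\ 0 < fine J.
Proof.
have mu1 : 1 < 2 :> R by rewrite ltr1n.
have [s [lam [h [rho [[h0 lam12 rho_gt0 us] [sd sY sc sr sg]]]]]] := fine_grid mu1.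
have [|JE S0 SJ _] := grid_integral mu1 h0 lam12 rho_gt0 us sd sY sc sr.
  by move=> a /sg[].
split=> //; have : 0 < 2 ^+ n * fine J by exact: lt_le_trans SJ.
by rewrite pmulr_rgt0// exprn_gt0.
Qed.

Theorem bregman_cover_upper (nu : R) : 1 < nu ->
  exists2 r0 : R, 0 < r0 & forall r, 0 < r < r0 ->
    covers (fun y c => 2 * D y c <= r ^+ 2) Y (nu * (k1 * fine J) / r ^+ n).
Proof.
(* Budget: [mu] for the covering constant, and [mu ^+ n] each for the inflated cubes, for the
   reduced radius [r / mu] and for comparing the sum with the integral. *)
move=> nu1; have [mu mu1 munu] := exp_root_gt1 (3 * n).+1 nu1.
have mu0 : 0 < mu by exact: lt_trans mu1.
have [s [lam [h [rho [[h0 lam12 rho_gt0 us] [sd sY sc sr sg]]]]]] := fine_grid mu1.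
have [lam1 lammu] := andP lam12.
have lam0 : 0 < lam by exact: lt_trans lam1.
have [|JE S0 SJ _] := grid_integral mu1 h0 lam12 rho_gt0 us sd sY sc sr.
  by move=> a /sg[].
have kg a : covering_constant (Hs a) = k1 * g a by exact: covering_constant_det.
have kgt0 a : 0 < covering_constant (Hs a) by rewrite kg mulr_gt0// covering_constant1_gt0.
(* Radius [r / mu] guarantees [2 * D y c <= mu ^+ 2 * (r / mu) ^+ 2 = r ^+ 2]. *)
have [|r1 r10 hr1] := @eventually_all_seq _ s (fun a r =>
    covers (ball_rel (Hs a) (r / mu)) (cube (p + lam *: (a - p)) (lam * h))
      (mu * covering_constant (Hs a) * (lam * h / (r / mu)) ^+ n)) _.
  move=> a sa; have [L0 L00 hL] := covering_constant_covers_large (kgt0 a) mu1.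
  exists (mu * (lam * h) / L0); first by rewrite divr_gt0// mulr_gt0// mulr_gt0.
  move=> r /andP[r0]; rewrite ltr_pdivlMr// => rr.
  have rmu : 0 < r / mu by rewrite divr_gt0.
  have /hL : L0 <= lam * h / (r / mu).
    rewrite ler_pdivlMr// mulrA ler_pdivrMr// mulrC (mulrC _ mu).
    exact: ltW.
  move=> /(covers_cube_scale (p + lam *: (a - p)) rmu).
  by rewrite mulr1 mulrCA mulfV ?mulr1// gt_eqF.
(* The second bound keeps a centre within [rho] of each point that it covers, hence within [2 * rho]
   of the corner. *)
exists (Num.min r1 (rho * Num.sqrt m)).
  by rewrite lt_min r10 mulr_gt0// sqrtr_gt0.
move=> r /andP[r0]; rewrite lt_min => /andP[rr1 rr2].
have rn : 0 < r ^+ n by exact: exprn_gt0.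
have rmu : 0 < r / mu by rewrite divr_gt0.
have cov : covers (fun y c => 2 * D y c <= r ^+ 2) Y
    (\sum_(a <- s) mu * covering_constant (Hs a) * (lam * h / (r / mu)) ^+ n).
  apply: (@covers_bigU _ _ _ s (fun a => [set y |
      cube (p + lam *: (a - p)) (lam * h) y /\ coord_dist_le y a rho])); last first.
    move=> y /sc[a sa [ay yr]]; exists a => //; split=> // i.
    by have /andP[-> /ltW] := ay i.
  move=> a sa; have := hr1 r; rewrite r0 rr1 => /(_ isT a sa) ca.
  apply: (covers_sub ca) => [y []//|y c [_ yr]|//].
  rewrite /ball_rel => hc; have [_ /(_ y c)] := sg a sa.
  have yr' : coord_dist_le y a (2 * rho).
    by move=> i; rewrite (le_trans (yr i))// ler_peMl ?ler1n// ltW.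
  move=> /(_ yr')[].
    move=> i; have := coord_le_sqnorm m0 (ltW rmu) (le_trans (Hsm a _) hc) i.
    rewrite !mxE => yc.
    have rm : r / mu / Num.sqrt m <= rho.
      rewrite ler_pdivrMr ?sqrtr_gt0// (le_trans _ (ltW rr2))//.
      by rewrite ler_pdivrMr// ler_peMr ?ltW.
    rewrite -(subrKA (y ord0 i)) (le_trans (ler_normD _ _))//.
    rewrite mulr_natl mulr2n; apply: lerD; last exact: yr.
    by rewrite distrC (le_trans yc).
  move=> /le_trans + _; apply.
  rewrite -ler_pdivlMl ?exprn_gt0// (le_trans hc)// expr_div_n.
  by rewrite mulrC.
apply: (covers_sub cov) => //.
have -> : \sum_(a <- s) mu * covering_constant (Hs a) * (lam * h / (r / mu)) ^+ n =
    mu * (lam * mu) ^+ n * (k1 * \sum_(a <- s) g a * h ^+ n) / r ^+ n.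
  rewrite mulr_sumr mulr_sumr mulr_suml; apply: eq_bigr => a _.
  have -> : lam * h / (r / mu) = lam * mu * h / r by field; rewrite !gt_eqF.
  by rewrite kg expr_div_n exprMn; ring.
rewrite ler_pM2r ?invr_gt0//.
apply: (@le_trans _ _ (mu * (lam * mu) ^+ n * (k1 * (mu ^+ n * fine J)))).
  rewrite ler_pM2l ?mulr_gt0// ?exprn_gt0 ?mulr_gt0//.
  by rewrite ler_pM2l// covering_constant1_gt0.
have kJ : 0 <= k1 * fine J.
  by rewrite mulr_ge0 ?(ltW covering_constant1_gt0)// ltW// (proj2 integral_finite_gt0).
have -> : mu * (lam * mu) ^+ n * (k1 * (mu ^+ n * fine J)) =
   mu * (lam ^+ n * mu ^+ n * mu ^+ n) * (k1 * fine J) by rewrite exprMn; ring.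
rewrite ler_wpM2r// (le_trans _ munu)// exprS ler_pM2l//.
have -> : (3 * n = n + n + n)%N by rewrite mulSn mul2n -addnn addnA.
rewrite !exprD ler_pM2r ?exprn_gt0// ler_pM2r ?exprn_gt0//.
by rewrite lerXn2r ?nnegrE// ltW.
Qed.

Theorem bregman_cover_lower (nu : R) : 1 < nu ->
  exists2 r0 : R, 0 < r0 & forall (r x : R), 0 < r < r0 ->
    covers (fun y c => 2 * D y c <= r ^+ 2) Y x -> k1 * fine J <= nu * x * r ^+ n.
Proof.
(* Budget: [2 * n] for side [h / mu] and radius [mu * r], and [2 * n] for comparing the integral
   with the sum. *)
move=> nu1; have [mu mu1 munu] := exp_root_gt1 (4 * n) nu1.
have mu0 : 0 < mu by exact: lt_trans mu1.
have [s [lam [h [rho [[h0 lam12 rho_gt0 us] [sd sY sc sr sg]]]]]] := fine_grid mu1.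
have [|JE S0 _ JS] := grid_integral mu1 h0 lam12 rho_gt0 us sd sY sc sr.
  by move=> a /sg[].
have kg a : covering_constant (Hs a) = k1 * g a by exact: covering_constant_det.
have l1 : 0 < mu^-1 < 1 by rewrite invr_gt0 mu0 invf_lt1.
have [l0' l1'] := andP l1.
(* Balls meeting the cubes shrunk by [tau] have their centre in the full cube, so
   each ball is counted once. *)
pose tau := h * (1 - mu^-1) / 2.
have tau0 : 0 < tau by rewrite divr_gt0// mulr_gt0// subr_gt0.
exists (tau * Num.sqrt m); first by rewrite mulr_gt0// sqrtr_gt0.
move=> r x /andP[r0 rtau] cx; have x0 := covers_ge0 cx; have [z [zx hz]] := cx.
have rn : 0 < r ^+ n by exact: exprn_gt0.
pose P a : pred 'rV[R]_n := fun c => `[< hcube a h c >].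
(* The cube of side [h / mu] is concentric with the cell, hence has corner [a + tau]. It is covered
   by the balls centred in the cell, and within the cell these lie in ellipsoids of radius
   [mu * r]. *)
have cnt a : a \in s ->
    covering_constant (Hs a) * (h / mu / (mu * r)) ^+ n <= (count (P a) z)%:R.
  move=> sa; apply: (@covering_constant_cover _ _ _ _ (\row_i (a ord0 i + tau))).
  - exact: mulr_gt0.
  - exact: divr_gt0.
  exists [seq c <- z | P a c]; split; first by rewrite size_filter.
  move=> y ya; have ya' i : a ord0 i + tau <= y ord0 i <= a ord0 i + h - tau.
    have := ya i; rewrite mxE => /andP[-> /le_trans]; apply.
    by rewrite /tau le_eqVlt; apply/orP; left; apply/eqP; field; rewrite gt_eqF.
  have ha : hcube a h y.
    by move=> i; have /andP[? ?] := ya' i; apply/andP; split; lra.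
  have [c cz Dc] := hz y (sY a sa _ ha).
  have yc := coord_le_sqnorm m0 (ltW r0) (le_trans (Dm y c) Dc).
  have rm : r / Num.sqrt m < tau by rewrite ltr_pdivrMr ?sqrtr_gt0.
  have ca : hcube a h c.
    move=> i; have := yc i; rewrite !mxE => /le_lt_trans /(_ rm).
    rewrite ltr_norml => /andP[? ?]; have /andP[? ?] := ya' i.
    by apply/andP; split; lra.
  exists c; first by rewrite mem_filter cz andbT; apply/asboolP.
  have rr u : hcube a h u -> coord_dist_le u a (2 * rho).
    move=> /(sr a u sa) h1 i.
    by rewrite (le_trans (h1 i))// ler_peMl ?ler1n// ltW.
  have [_ /(_ y c (rr _ ha) (rr _ ca))[_ /le_trans]] := sg a sa; apply.
  by rewrite exprMn ler_pM2l// exprn_gt0.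
have : (\sum_(a <- s) count (P a) z <= size z)%N.
  apply: sum_count_disjoint => // a a' c sa sa' /asboolP ca /asboolP ca'.
  exact: (sd a a' c).
rewrite -(ler_nat R) natr_sum => /le_trans /(_ zx) cntx.
have : k1 * (\sum_(a <- s) g a * h ^+ n) <= mu ^+ (2 * n) * x * r ^+ n.
  apply: (@le_trans _ _ ((mu ^+ (2 * n) * r ^+ n) *
      \sum_(a <- s) covering_constant (Hs a) * (h / mu / (mu * r)) ^+ n)).
    rewrite !mulr_sumr le_eqVlt; apply/orP; left; apply/eqP/eq_bigr => a _.
    rewrite kg; have -> : h / mu / (mu * r) = h / (mu ^+ 2 * r).
      by field; rewrite !gt_eqF.
    rewrite expr_div_n [(_ * r) ^+ n]exprMn -exprM.
    by field; rewrite !gt_eqF// exprn_gt0.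
  rewrite mulrAC ler_pM2r// ler_pM2l ?exprn_gt0// (le_trans _ cntx)//.
  rewrite big_seq [leRHS]big_seq; apply: ler_sum => a; exact: cnt.
move=> kS.
apply: (@le_trans _ _ (mu ^+ (2 * n) * (k1 * \sum_(a <- s) g a * h ^+ n))).
  by rewrite mulrCA ler_pM2l// covering_constant1_gt0.
apply: (@le_trans _ _ (mu ^+ (2 * n) * (mu ^+ (2 * n) * x * r ^+ n))).
  by rewrite ler_pM2l// exprn_gt0.
rewrite mulrA mulrA ler_pM2r// ler_wpM2r// -exprD (le_trans _ munu)//.
by rewrite -mulnDl.
Qed.

End asymptotics.

(** * Second-order Taylor expansion *)

Section second_order.
Context {R : realType} {n : nat}.
Implicit Types (f : 'rV[R]_n -> R) (x y z u v : 'rV[R]_n).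

Lemma is_derive_line f z v (s : R) : derivable f (z + s *: v) v ->
  is_derive s 1 (fun s => f (z + s *: v)) ('D_v f (z + s *: v)).
Proof.
have E : (fun h : R =>
      h^-1 *: (((fun s => f (z + s *: v)) \o shift s) (h *: 1) - f (z + s *: v))) =
    (fun h : R => h^-1 *: ((f \o shift (z + s *: v)) (h *: v) - f (z + s *: v))).
  apply/funext => h /=; congr (_ *: (f _ - _)).
  have -> : h *: (1 : R) = h by exact: mulr1.
  by rewrite scalerDl addrCA.
by move=> fd; split; rewrite /derivable /derive E.
Qed.

Lemma within_continuous_derive (g g1 : R -> R) (a b : R) :
  (forall s : R, is_derive s 1 g (g1 s)) -> {within `[a, b], continuous g}.
Proof.
move=> dg; apply: continuous_subspaceT => s.
apply: differentiable_continuous; apply/derivable1_diffP; exact: ex_derive.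
Qed.

(* Rolle's theorem for [g] minus its interpolating parabola. *)
Lemma taylor_lagrange1 (g g1 g2 : R -> R) :
  (forall s : R, is_derive s 1 g (g1 s)) ->
  (forall s : R, is_derive s 1 g1 (g2 s)) ->
  exists2 s : R, 0 < s < 1 & g 1 - g 0 - g1 0 = g2 s / 2.
Proof.
move=> dg dg1; pose C := g 1 - g 0 - g1 0.
pose h := fun s : R => g s - (g1 0 * s + C * (s * s)).
have dh (s : R) : is_derive s 1 h (g1 s - (g1 0 + 2 * C * s)).
  rewrite /h; have := dg s => ?; apply: is_derive_eq.
  by rewrite /GRing.scale /=; ring.
have [||s s01 hs] := @Rolle R h 0 1 ltr01 _ (within_continuous_derive dh).
- by move=> s _; apply: ex_derive.
- by rewrite /h /C; ring.
have hs0 : g1 s - g1 0 = 2 * C * s.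
  have := dh s => dhs; have := @derive_val _ _ _ _ _ _ _ hs.
  by rewrite (@derive_val _ _ _ _ _ _ _ dhs) => ?; lra.
move: s01; rewrite in_itv /= => /andP[s0 s1].
have [e] := @MVT R g1 g2 0 s s0 (fun (r : R) _ => dg1 r) (within_continuous_derive dg1).
rewrite in_itv /= => /andP[e0 es]; rewrite subr0 hs0 => /mulIf => hC.
exists e; first by rewrite e0 (lt_trans es).
by rewrite -hC ?gt_eqF// /C; field.
Qed.

Lemma derive_sum_basis f x v : differentiable f x ->
  'D_v f x = \sum_(i < n) v ord0 i * 'D_(delta_mx ord0 i) f x.
Proof.
move=> df; rewrite deriveE// [in LHS](row_sum_delta v) linear_sum /=.
by apply: eq_bigr => i _; rewrite linearZ /= deriveE.
Qed.

Lemma derive_gradient f x v : differentiable f x ->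
  'D_v f x = dotv (gradient f x) v.
Proof.
move=> /derive_sum_basis ->; apply: eq_bigr => i _.
by rewrite mxE mulrC.
Qed.

Lemma differentiable_partial f x i : differentiable (gradient f) x ->
  differentiable ('D_(delta_mx ord0 i) f) x.
Proof.
move=> df; have -> : 'D_(delta_mx ord0 i) f = (fun M : 'rV[R]_n => M ord0 i) \o gradient f.
  by apply/funext => y /=; rewrite mxE.
by apply: differentiable_comp => //; exact: differentiable_coord.
Qed.

Lemma derive_partial f x v i : differentiable (gradient f) x ->
  'D_v ('D_(delta_mx ord0 i) f) x = \sum_(j < n) v ord0 j * hessian f x j i.
Proof.
move=> /differentiable_partial df; rewrite derive_sum_basis//.
by apply: eq_bigr => j _; rewrite mxE.
Qed.

Lemma taylor_lagrange f z v : twice_continuously_differentiable f ->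
  exists2 s : R, 0 < s < 1 &
    f (z + v) - f z - dotv (gradient f z) v = qform (hessian f (z + s *: v)) v / 2.
Proof.
move=> [df dg _].
have d1 (s : R) : is_derive s 1 (fun s => f (z + s *: v)) (dotv (gradient f (z + s *: v)) v).
  rewrite -(derive_gradient v (df (z + s *: v))); apply: is_derive_line.
  exact: diff_derivable.
have d2 (s : R) : is_derive s 1 (fun s => dotv (gradient f (z + s *: v)) v)
    (qform (hessian f (z + s *: v)) v).
  have di i : is_derive s 1 (fun s => 'D_(delta_mx ord0 i) f (z + s *: v))
      (\sum_(j < n) v ord0 j * hessian f (z + s *: v) j i).
    rewrite -(derive_partial v i (dg (z + s *: v))); apply: is_derive_line.
    exact/diff_derivable/differentiable_partial.
  have H : is_derive s 1
      (\sum_(i < n) (v ord0 i \*: (fun s : R => 'D_(delta_mx ord0 i) f (z + s *: v))))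
      (\sum_(i < n) v ord0 i *: \sum_(j < n) v ord0 j * hessian f (z + s *: v) j i).
    by apply: is_derive_sum => i; apply: is_deriveZ; exact: di.
  have E : \sum_(i < n) (v ord0 i \*: (fun s : R => 'D_(delta_mx ord0 i) f (z + s *: v)))
      = (fun s : R => dotv (gradient f (z + s *: v)) v).
    apply/funext => u; rewrite fct_sumE /dotv; apply: eq_bigr => i _.
    by rewrite mxE mulrC.
  rewrite -E; apply: is_derive_eq.
  rewrite qformE exchange_big /=; apply: eq_bigr => i _.
  by rewrite /GRing.scale /= mulr_sumr; apply: eq_bigr => j _; ring.
have [s s01] := taylor_lagrange1 d1 d2.
by rewrite scale1r scale0r addr0 => E; exists s.
Qed.

Lemma rectangle_MVT f (h : R) x u w :
  0 < h -> (forall y, derivable f y u) -> (forall y, derivable ('D_u f) y w) ->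
  exists s e : R, [/\ 0 < s < h, 0 < e < h &
    f (x + h *: u + h *: w) - f (x + h *: u) - f (x + h *: w) + f x =
    h * h * 'D_w ('D_u f) (x + s *: u + e *: w)].
Proof.
move=> h0 df ddf.
pose G := fun s : R => f (x + h *: w + s *: u) - f (x + s *: u).
have dG (s : R) : is_derive s 1 G ('D_u f (x + h *: w + s *: u) - 'D_u f (x + s *: u)).
  by apply: is_deriveB; exact: is_derive_line.
have [s] := MVT h0 (fun s _ => dG s) (within_continuous_derive dG).
rewrite in_itv /= subr0 => s0h Gs.
pose K := fun e : R => 'D_u f (x + s *: u + e *: w).
have dK (e : R) : is_derive e 1 K ('D_w ('D_u f) (x + s *: u + e *: w)).
  exact: is_derive_line.
have [e] := MVT h0 (fun s _ => dK s) (within_continuous_derive dK).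
rewrite in_itv /= subr0 => e0h Ke.
exists s, e; split=> //.
have -> : h * h * 'D_w ('D_u f) (x + s *: u + e *: w) = G h - G 0.
  have K0 : 'D_u f (x + s *: u) = K 0 by rewrite /K scale0r addr0.
  have Kh : 'D_u f (x + h *: w + s *: u) = K h by rewrite /K addrAC.
  by rewrite Gs K0 Kh Ke; ring.
by rewrite /G !scale0r !addr0 (addrAC x); ring.
Qed.

(** Schwarz's theorem: [rectangle_MVT], applied in both orders to one second difference, equates the
    two mixed derivatives at points near [x], and continuity brings both to [x]. *)
Lemma hessian_sym f x : twice_continuously_differentiable f ->
  (hessian f x)^T = hessian f x.
Proof.
move=> [df dg hc]; apply/matrixP => i j; rewrite mxE.
pose ei : 'rV[R]_n := delta_mx ord0 i; pose ej : 'rV[R]_n := delta_mx ord0 j.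
have cont k l : continuous (fun y => hessian f y k l).
  move=> y; apply: (@continuous_comp _ _ _ (hessian f) (fun M : 'M[R]_n => M k l)).
    exact: hc.
  exact: coord_continuous.
apply/eqP; rewrite -subr_eq0 -normr_eq0 eq_le normr_ge0 andbT.
apply/ler_addgt0Pr => e e0; rewrite add0r.
have e20 : 0 < e / 2 by rewrite divr_gt0.
have /cvgrPdist_lt /(_ _ e20) /nbhs_ballP[d1 /= d10 h1] := cont j i x.
have /cvgrPdist_lt /(_ _ e20) /nbhs_ballP[d2 /= d20 h2] := cont i j x.
pose d := Num.min d1 d2.
have d0 : 0 < d by rewrite lt_min d10.
pose h := d / 4; have h0 : 0 < h by rewrite divr_gt0.
have dp k y u : derivable ('D_(delta_mx ord0 k) f) y u.
  exact/diff_derivable/differentiable_partial.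
have close (s t : R) u v : `|u| <= 1 -> `|v| <= 1 -> 0 < s < h -> 0 < t < h ->
    `|x - (x + s *: u + t *: v)| < d.
  move=> u1 v1 /andP[s0 sh] /andP[t0 th].
  rewrite -addrA opprD addrA subrr add0r normrN (le_lt_trans (ler_normD _ _))//.
  rewrite !normrZ (gtr0_norm s0) (gtr0_norm t0).
  have : s * `|u| <= h by rewrite (le_trans _ (ltW sh))// ler_piMr// ltW.
  have : t * `|v| <= h by rewrite (le_trans _ (ltW th))// ler_piMr// ltW.
  have : h + h < d by rewrite /h; lra.
  by clear; lra.
have n1 k : `|delta_mx ord0 k : 'rV[R]_n| <= 1.
  by apply/rV_norm_le => // l; rewrite mxE eqxx /=; case: eqP; rewrite ?normr1 ?normr0.
have [s [t [sh th E1]]] := @rectangle_MVT f h x ei ej h0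
  (fun y => diff_derivable (df y)) (fun y => dp _ _ _).
have [s' [t' [s'h t'h E2]]] := @rectangle_MVT f h x ej ei h0
  (fun y => diff_derivable (df y)) (fun y => dp _ _ _).
pose P := x + s *: ei + t *: ej; pose P' := x + s' *: ej + t' *: ei.
have a1 : `|hessian f x j i - hessian f P j i| < e / 2.
  apply: (h1 P); rewrite -ball_normE /=.
  by apply: (lt_le_trans (close _ _ _ _ (n1 _) (n1 _) sh th)); rewrite ge_min lexx.
have a2 : `|hessian f x i j - hessian f P' i j| < e / 2.
  apply: (h2 P'); rewrite -ball_normE /=.
  by apply: (lt_le_trans (close _ _ _ _ (n1 _) (n1 _) s'h t'h)); rewrite ge_min lexx orbT.
have EE : hessian f P j i = hessian f P' i j.
  rewrite [LHS]mxE [RHS]mxE; have hh : h * h != 0 by rewrite mulf_neq0// gt_eqF.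
  apply: (mulfI hh); apply: (etrans (esym E1)); apply: (etrans _ E2).
  rewrite (addrAC x (h *: ej) (h *: ei)).
  move: (f (x + h *: ei + h *: ej)) (f (x + h *: ei)) (f (x + h *: ej)) (f x) => c1 c2 c3 c4.
  by rewrite -(addrA c1) (addrC (- c2)) addrA.
rewrite EE in a1.
apply: (@le_trans _ _ (e / 2 + e / 2)); last by rewrite -splitr.
rewrite -(subrKA (hessian f P' i j)) (le_trans (ler_normD _ _))//.
by apply: lerD; [exact: ltW|rewrite distrC; exact: ltW].
Qed.

End second_order.

(** * The Bregman divergence of a semiconvex function *)

Section bregman.
Context {R : realType} {n : nat}.
Implicit Types (x y z u v : 'rV[R]_n).

Lemma sqnorm_ge0 v : 0 <= sqnorm v.
Proof. by rewrite sumr_ge0// => i _; rewrite -expr2 sqr_ge0. Qed.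

Lemma sqnorm_gt0 v : v != 0 -> 0 < sqnorm v.
Proof.
move=> v0; rewrite lt_neqAle sqnorm_ge0 andbT eq_sym; apply: contra v0.
rewrite psumr_eq0 => [/allP v0|i _]; last by rewrite -expr2 sqr_ge0.
apply/eqP/rowP => i; rewrite mxE; have := v0 i (mem_index_enum _).
by rewrite /= -expr2 sqrf_eq0 => /eqP.
Qed.

Lemma dotvDl x y v : dotv (x + y) v = dotv x v + dotv y v.
Proof. by rewrite -big_split; apply: eq_bigr => i _; rewrite mxE mulrDl. Qed.

Lemma dotvC x y : dotv x y = dotv y x.
Proof. by apply: eq_bigr => i _; rewrite mulrC. Qed.

Lemma dotvDr x y v : dotv v (x + y) = dotv v x + dotv v y.
Proof. by rewrite !(dotvC v) dotvDl. Qed.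

Lemma dotvZl (k : R) x v : dotv (k *: x) v = k * dotv x v.
Proof. by rewrite /dotv mulr_sumr; apply: eq_bigr => i _; rewrite mxE mulrA. Qed.

Lemma dotvZr (k : R) x v : dotv v (k *: x) = k * dotv v x.
Proof. by rewrite !(dotvC v) dotvZl. Qed.

Lemma dotvNl x v : dotv (- x) v = - dotv x v.
Proof. by rewrite -scaleN1r dotvZl mulN1r. Qed.

Lemma dotvNr x v : dotv v (- x) = - dotv v x.
Proof. by rewrite !(dotvC v) dotvNl. Qed.

Lemma sqnormD x y : sqnorm (x + y) = sqnorm x + 2 * dotv x y + sqnorm y.
Proof. by rewrite /sqnorm !(dotvDl, dotvDr) (dotvC y x); ring. Qed.

Lemma sqnormZ (k : R) x : sqnorm (k *: x) = k ^+ 2 * sqnorm x.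
Proof. by rewrite /sqnorm dotvZl dotvZr mulrA expr2. Qed.

Lemma sqnormN x : sqnorm (- x) = sqnorm x.
Proof. by rewrite /sqnorm dotvNl dotvNr opprK. Qed.

Lemma qformD_scalar (A : 'M[R]_n) (c : R) v :
  qform (A + c%:M) v = qform A v + c * sqnorm v.
Proof.
rewrite /qform mulmxDr mulmxDl mxE mul_mx_scalar -scalemxAl [in X in _ + X]mxE.
by congr (_ + _ * _); rewrite -qform1 /qform mulmx1.
Qed.

Lemma convex_functionP (f : 'rV[R]_n -> R) x y (k : R) :
  convex_function setT f -> 0 <= k <= 1 ->
  f (k *: x + (1 - k) *: y) <= k * f x + (1 - k) * f y.
Proof.
move=> cf /andP[k0 k1].
exact: (cf (Itv01 k0 k1) x y (mem_set I) (mem_set I)).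
Qed.

Lemma mx_entry_le_norm p q (M : 'M[R]_(p, q)) i j : `|M i j| <= `|M|.
Proof.
rewrite {2}/Num.norm /= mx_normrE.
exact: (@le_bigmax _ _ _ _ (fun ij => `|M ij.1 ij.2|) (i, j)).
Qed.

Lemma qform_cvg (H : 'rV[R]_n -> 'M[R]_n) v x (e : R) : continuous H -> 0 < e ->
  exists2 d : R, 0 < d & forall y, `|x - y| < d ->
    `|qform (H x) v - qform (H y) v| <= e.
Proof.
move=> cH e0.
pose C := \sum_(i < n) \sum_(j < n) `|v ord0 i * v ord0 j|.
have C0 : 0 <= C by rewrite sumr_ge0// => i _; rewrite sumr_ge0.
have C1 : 0 < C + 1 by rewrite ltr_wpDl.
have /cvgrPdist_lt /(_ (e / (C + 1))) := cH x.
rewrite divr_gt0// => /(_ isT) /nbhs_ballP[d d0 hd].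
exists d => // y yd; have hy : `|H x - H y| < e / (C + 1).
  by apply: hd; rewrite -ball_normE.
rewrite /= !qformE -sumrB; under eq_bigr do rewrite -sumrB.
apply: (@le_trans _ _ (C * (e / (C + 1)))); last first.
  by rewrite mulrCA ler_piMr ?(ltW e0)// ler_pdivrMr// mul1r lerDl.
rewrite (le_trans (ler_norm_sum _ _ _))// mulr_suml; apply: ler_sum => i _.
rewrite (le_trans (ler_norm_sum _ _ _))// mulr_suml; apply: ler_sum => j _.
rewrite -mulrBr normrM ler_wpM2l// (le_trans _ (ltW hy))//.
by have := mx_entry_le_norm (H x - H y) i j; rewrite [_ i j]mxE [X in _ + X]mxE.
Qed.

Lemma qform_perturb (A B : 'M[R]_n) (e : R) v :
  (forall i j, `|A i j - B i j| <= e) ->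
  qform A v <= qform B v + e * n%:R ^+ 2 * sqnorm v.
Proof.
move=> AB; rewrite -lerBlDl !qformE -sumrB; under eq_bigr do rewrite -sumrB.
have -> : e * n%:R ^+ 2 * sqnorm v = \sum_(i < n) \sum_(j < n) e * sqnorm v.
  by rewrite !sumr_const !card_ord -mulrnA -[RHS]mulr_natr natrM expr2; ring.
apply: ler_sum => i _; apply: ler_sum => j _; rewrite -mulrBr.
rewrite (le_trans (ler_norm _))// normrM mulrC ler_pM//.
have vk k : `|v ord0 k| ^+ 2 <= sqnorm v.
  rewrite real_normK ?num_real// /sqnorm /dotv (bigD1 k)//= -expr2 lerDl.
  by rewrite sumr_ge0// => l _; rewrite -expr2 sqr_ge0.
rewrite normrM; have := vk i; have := vk j.
move: `|v ord0 i| `|v ord0 j| (sqnorm v) => a b w; rewrite !expr2; nra.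
Qed.

(** A Heine-Cantor argument in which [x] may lie outside [Y]: compactness is applied to a property
    of the pair of radius and base point. *)
Lemma uniform_entries (H : 'rV[R]_n -> 'M[R]_n) (Y : set 'rV[R]_n) (e : R) :
  continuous H -> compact Y -> 0 < e ->
  exists2 rho : R, 0 < rho & forall a, Y a -> forall x, coord_dist_le x a rho ->
    forall i j, `|H x i j - H a i j| <= e.
Proof.
move=> cH /compact_near_coveringP cY e0.
pose P (r : R) (a : 'rV[R]_n) := forall x, coord_dist_le x a r ->
    forall i j, `|H x i j - H a i j| <= e.
have e20 : 0 < e / 2 by rewrite divr_gt0.
have [|d /= d0 hd] := cY R (0 : R)^'+ P _ _; last first.
  exists (d / 2) => [|a Ya]; first by rewrite divr_gt0.
  apply: hd => //=; last by rewrite divr_gt0.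
  by rewrite sub0r normrN gtr0_norm ?divr_gt0// ltr_pdivrMr// ltr_pMr// ltr1n.
move=> x Yx.
have /cvgrPdist_lt /(_ _ e20) /nbhs_ballP[d d0 hd] := cH x.
have d20 : 0 < d / 2 by rewrite divr_gt0.
exists (ball x (d / 2), [set r : R | 0 < r < d / 2]) => /=.
  split; first exact: nbhsx_ballx.
  exists (d / 2) => //= r; rewrite /ball_ /= sub0r normrN => rd r0.
  by rewrite r0 (le_lt_trans (ler_norm r)).
move=> [a r] /= [xa /andP[r0 rd]] y ya i j.
have ha : `|H x - H a| < e / 2.
  by apply: hd; apply: le_ball xa; rewrite ler_pdivrMr// ler_peMr ?ler1n// ltW.
have hy : `|H x - H y| < e / 2.
  apply: hd; rewrite -ball_normE /=; move: xa; rewrite -ball_normE /= => xa.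
  have -> : x - y = (x - a) - (y - a) by rewrite opprB addrA subrK.
  rewrite (splitr d) (le_lt_trans (ler_normB _ _))// ltr_leD// ?(ltW rd)//.
  apply/rV_norm_le; first exact: ltW.
  by move=> k; rewrite mxE [X in _ + X]mxE (le_trans (ya k))// ltW.
have h1 := le_lt_trans (mx_entry_le_norm (H x - H a) i j) ha.
have h2 := le_lt_trans (mx_entry_le_norm (H x - H y) i j) hy.
rewrite [_ i j]mxE [X in _ + X]mxE in h1; rewrite [_ i j]mxE [X in _ + X]mxE in h2.
rewrite -(subrKA (H x i j)) (le_trans (ler_normD _ _))// (splitr e) lerD//.
  by rewrite distrC ltW.
exact: ltW.
Qed.

Let midpoint_arith (a1 a2 a3 b k ny dv nv : R) :
  a3 + b / 2 * ny <=
    2^-1 * (a1 + b / 2 * (ny + 2 * (k * dv) + k ^+ 2 * nv)) +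
    (1 - 2^-1) * (a2 + b / 2 * (ny + 2 * (- k * dv) + k ^+ 2 * nv)) ->
  2 * a3 <= a1 + a2 + b * k ^+ 2 * nv.
Proof. by move=> h; lra. Qed.

(** Adding the expansions at [tau] and [- tau] cancels the linear term. If [q y + b * N] were
    negative, continuity would keep [q] at most [- (b * N) - e] along both segments, against the
    lower bound on second differences. *)
Lemma second_difference_ge0 (f q : 'rV[R]_n -> R) (G N b : R) y v :
  (forall e : R, 0 < e -> exists2 d : R, 0 < d & forall x, `|y - x| < d ->
    `|q y - q x| <= e) ->
  (forall k : R, exists2 s : R, 0 < s < 1 &
    f (y + k *: v) - f y - k * G = k ^+ 2 * q (y + (s * k) *: v) / 2) ->
  (forall k : R, 2 * f y <= f (y + k *: v) + f (y + (- k) *: v) + b * k ^+ 2 * N) ->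
  0 <= q y + b * N.
Proof.
move=> qc tay cvx; rewrite leNgt; apply/negP => neg.
pose e := - (q y + b * N) / 2.
have e0 : 0 < e by rewrite divr_gt0// oppr_gt0.
have [d d0 hd] := qc e e0.
have v1 : 0 < `|v| + 1 by rewrite ltr_wpDl.
pose tau := d / (2 * (`|v| + 1)).
have tau0 : 0 < tau by rewrite divr_gt0// mulr_gt0.
have tauv : tau * `|v| < d.
  have -> : tau * `|v| = d * (`|v| / (2 * (`|v| + 1))) by rewrite /tau; ring.
  by rewrite gtr_pMr// ltr_pdivrMr ?mulr_gt0//; lra.
have t (k : R) : `|k| = tau -> f (y + k *: v) - f y - k * G <= k ^+ 2 * (q y + e) / 2.
  move=> kt; have [s /andP[s0 s1] ->] := tay k.
  rewrite ler_pM2r ?invr_gt0// ler_wpM2l ?sqr_ge0//.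
  have : `|q y - q (y + (s * k) *: v)| <= e.
    apply: hd; rewrite opprD addrA subrr sub0r normrN normrZ normrM gtr0_norm// kt.
    by rewrite (le_lt_trans _ tauv)// ler_wpM2r// ler_piMl// ltW.
  by rewrite ler_norml => /andP[q1 _]; lra.
have t1 := t tau (gtr0_norm tau0).
have t2 := t (- tau) (etrans (normrN _) (gtr0_norm tau0)).
have t3 := cvx tau; have t4 := mulr_gt0 (exprn_gt0 2 tau0) e0.
rewrite sqrrN mulNr in t2.
have qe : q y + e = - (b * N) - e by rewrite /e; field.
by rewrite qe in t1 t2; lra.
Qed.

Let perturb_arith (A A' B B' M w m k N : R) :
  A' = A + k * N -> B' = B + k * N -> 0 <= M - 1 -> 0 <= N ->
  w <= (M - 1) * m -> A <= B + w * N -> m * N <= B' -> A' <= M * B'.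
Proof.
move=> -> -> M1 N0 wm AB mB.
have h1 := ler_wpM2r N0 wm; have h2 := ler_wpM2l M1 mB.
by lra.
Qed.

Let segment_arith (y z a s r : R) : 0 < s -> s < 1 -> `|y - a| <= r -> `|z - a| <= r ->
  `|z + s * (y - z) - a| <= r.
Proof.
move=> s0 s1 ya za; have -> : z + s * (y - z) - a = s * (y - a) + (1 - s) * (z - a).
  by ring.
have s1' : 0 < 1 - s by rewrite subr_gt0.
rewrite (le_trans (ler_normD _ _))// !normrM (gtr0_norm s0) (gtr0_norm s1').
have h1 := ler_wpM2l (ltW s0) ya.
have h2 : (1 - s) * `|z - a| <= (1 - s) * r by rewrite ler_wpM2l// subr_ge0 ltW.
by lra.
Qed.

Section strongly_convex.
Context (f : 'rV[R]_n -> R) (alpha c : R).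
Context (f2 : twice_continuously_differentiable f)
  (fc : semiconvex (1 - alpha) f) (cm : 0 < c - (1 - alpha)).

(* The Hessian of [f + c / 2 |.|^2]; [bregman] is the Bregman divergence of that
   function. *)
Definition shifted_hessian y : 'M[R]_n := hessian f y + c%:M.

Definition bregman y z : R :=
  f y - f z - dotv (gradient f z) (y - z) + c / 2 * sqnorm (y - z).

Lemma bregman_taylor y z : exists2 s : R, 0 < s < 1 &
  2 * bregman y z = qform (shifted_hessian (z + s *: (y - z))) (y - z).
Proof.
have [s s01] := taylor_lagrange z (y - z) f2.
rewrite (addrC z) subrK => E; exists s => //.
by rewrite /bregman E /shifted_hessian qformD_scalar; field.
Qed.

Lemma semiconvex_hessian_ge y v :
  0 <= qform (hessian f y) v + (1 - alpha) * sqnorm v.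
Proof.
have [_ _ hc] := f2.
apply: (@second_difference_ge0 f (fun x => qform (hessian f x) v)
  (dotv (gradient f y) v)) => [e e0|k|k].
- exact: qform_cvg.
- have [s s01 E] := taylor_lagrange y (k *: v) f2; exists s => //.
  by rewrite qformZ in E; rewrite dotvZr in E; rewrite scalerA in E; exact: E.
- have half : 0 <= (2^-1 : R) <= 1 by rewrite invr_ge0 ler0n invf_le1 ?ltr0n// ler1n.
  have := convex_functionP (y + k *: v) (y + (- k) *: v) fc half.
  have -> : 2^-1 *: (y + k *: v) + (1 - 2^-1) *: (y + - k *: v) = y.
    by apply/rowP => i; rewrite !mxE; field.
  rewrite !sqnormD !sqnormZ !dotvZr sqrrN.
  exact: midpoint_arith.
Qed.

Lemma shifted_hessian_ge y v :
  (c - (1 - alpha)) * sqnorm v <= qform (shifted_hessian y) v.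
Proof.
rewrite /shifted_hessian qformD_scalar mulrBl.
by have := semiconvex_hessian_ge y v => ?; lra.
Qed.

Lemma shifted_hessian_posdef y : posdef (shifted_hessian y).
Proof.
split; first by rewrite linearD /= tr_scalar_mx hessian_sym.
move=> v v0; apply: lt_le_trans (shifted_hessian_ge y v).
by rewrite mulr_gt0// sqnorm_gt0.
Qed.

Lemma bregman_ge y z : (c - (1 - alpha)) * sqnorm (y - z) <= 2 * bregman y z.
Proof.
by have [s _ ->] := bregman_taylor y z; exact: shifted_hessian_ge.
Qed.

Lemma bregman_locally_quadratic (Y : set 'rV[R]_n) : compact Y ->
  locally_quadratic shifted_hessian bregman Y.
Proof.
move=> cY mu mu1; have [_ _ hc] := f2.
have mu2 : 0 < mu ^+ 2 - 1 by rewrite subr_gt0 expr_gt1// (le_trans _ (ltW mu1)).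
pose m := c - (1 - alpha); have n1 : 0 < n%:R ^+ 2 + 1 :> R by rewrite ltr_wpDl// sqr_ge0.
(* Chosen with [e * n ^ 2 <= (mu ^ 2 - 1) * m]: the additive error of [qform_perturb] is absorbed by
   the lower bound [m * |v| ^ 2] of the form. *)
pose e := (mu ^+ 2 - 1) * m / (n%:R ^+ 2 + 1).
have e0 : 0 < e by rewrite divr_gt0// mulr_gt0.
have [rho rho0 hrho] := uniform_entries hc cY e0.
exists rho => // a Ya.
have en : e * n%:R ^+ 2 <= (mu ^+ 2 - 1) * m.
  rewrite /e mulrAC -mulrA ler_piMr ?mulr_ge0 ?(ltW mu2) ?(ltW cm)//.
  by rewrite ler_pdivrMr// mul1r lerDl.
have key x x' v : (forall i j, `|hessian f x i j - hessian f x' i j| <= e) ->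
    qform (shifted_hessian x) v <= mu ^+ 2 * qform (shifted_hessian x') v.
  move=> hx; have h1 := qform_perturb v hx.
  exact: (perturb_arith (qformD_scalar (hessian f x) c v)
    (qformD_scalar (hessian f x') c v) (ltW mu2) (sqnorm_ge0 v) en h1
    (shifted_hessian_ge x' v)).
have hx x : coord_dist_le x a rho -> forall v,
    qform (shifted_hessian x) v <= mu ^+ 2 * qform (shifted_hessian a) v /\
    qform (shifted_hessian a) v <= mu ^+ 2 * qform (shifted_hessian x) v.
  move=> xa v; have h := hrho a Ya x xa.
  have h' i j : `|hessian f a i j - hessian f x i j| <= e by rewrite distrC; exact: h.
  exact: (conj (key x a v h) (key a x v h')).
split=> // y z ya za; have [s /andP[s0 s1] ->] := bregman_taylor y z.
apply: hx => i; have yi := ya i; have zi := za i.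
have -> : (z + s *: (y - z)) ord0 i = z ord0 i + s * (y ord0 i - z ord0 i).
  by rewrite !mxE.
exact: segment_arith.
Qed.

End strongly_convex.

End bregman.

(** * Max-plus approximation and Bregman coverings *)

Section minorants.
Context {R : realType} {n : nat}.
Implicit Types (x y z u v p : 'rV[R]_n).

Lemma differentiable_dotv p y : differentiable (dotv p) y.
Proof.
have -> : dotv p = \sum_(i < n) (fun z => p ord0 i *: z ord0 i).
  by apply/funext => z; rewrite fct_sumE.
by apply: differentiable_sum => i; apply: differentiableZ; exact: differentiable_coord.
Qed.

Lemma differentiable_sqnorm y : differentiable (@sqnorm R n) y.
Proof.
have -> : @sqnorm R n = \sum_(i < n) (fun z => z ord0 i * z ord0 i).
  by apply/funext => z; rewrite fct_sumE.
by apply: differentiable_sum => i; apply: differentiableM; exact: differentiable_coord.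
Qed.

Lemma continuous_coercive_min (F : 'rV[R]_n -> R) x (B : R) :
  continuous F -> (forall y, F y <= F x -> forall i, `|y ord0 i| <= B) ->
  exists z, forall y, F z <= F y.
Proof.
move=> cF FB; pose A := [set v : 'rV[R]_n | forall i, `[- B, B]%classic (v ord0 i)].
have cA : compact A.
  by apply: (rV_compact (A := fun=> `[- B, B]%classic)) => _; exact: segment_compact.
have inA y : (forall i, `|y ord0 i| <= B) -> A y.
  by move=> yB i; rewrite /= in_itv /= -ler_norml.
have Ax : A x by apply: inA; apply: FB.
have [z _ zmin] := EVT_min_rV (ex_intro _ x Ax) cA (continuous_subspaceT cF).
exists z => y; have [yx|xy] := leP (F y) (F x); last first.
  by apply: le_trans (ltW xy); exact/zmin/mem_set.
by apply/zmin/mem_set/inA; exact: FB.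
Qed.

Section strongly_convex.
Context (f : 'rV[R]_n -> R) (alpha c : R).
Context (f2 : twice_continuously_differentiable f)
  (fc : semiconvex (1 - alpha) f) (cm : 0 < c - (1 - alpha)).

Local Notation phi := (fun y => f y + c / 2 * sqnorm y).

(** The hypothesis says that [phi] has gradient [p] at [z], tested against all vectors. *)
Lemma bregman_affine p z : (forall v, dotv (gradient f z) v = dotv p v - c * dotv z v) ->
  forall y, bregman f c y z = (phi y - dotv p y) - (phi z - dotv p z).
Proof.
move=> g y; rewrite /bregman g !dotvDr sqnormD !dotvNr sqnormN (dotvC y z).
rewrite -/(sqnorm z).
by field.
Qed.

Let coercive_arith (m sy d sq w : R) : 0 < m ->
  m * sy <= 2 * (w + d) -> w <= 0 ->
  0 <= sq + 2 * (- (m / 2) * d) + (- (m / 2)) ^+ 2 * sy -> m ^+ 2 * sy <= 4 * sq.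
Proof.
move=> m0 h1 w0 h2; have h3 : m * (m * sy) <= m * (2 * d) by rewrite ler_pM2l//; lra.
by rewrite expr2 in h2 *; lra.
Qed.

(* Strong convexity makes [phi - <p, .>] coercive. *)
Lemma gradient_surjective p : exists z, forall v,
  dotv (gradient f z) v = dotv p v - c * dotv z v.
Proof.
pose F y := phi y - dotv p y; pose q := p - gradient f 0.
have [df _ _] := f2.
have dF y : differentiable F y.
  apply: differentiableB; last exact: differentiable_dotv.
  apply: differentiableD => //; apply: (@differentiableZ _ _ _ (@sqnorm R n) (c / 2)).
  exact: differentiable_sqnorm.
have cF : continuous F by move=> y; exact: differentiable_continuous.
pose m := c - (1 - alpha).
have sq0 : sqnorm (0 : 'rV[R]_n) = 0.
  by rewrite -(scale0r (0 : 'rV[R]_n)) sqnormZ expr0n mul0r.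
have d0 u : dotv u (0 : 'rV[R]_n) = 0.
  by rewrite -(scale0r (0 : 'rV[R]_n)) dotvZr mul0r.
have [|z zmin] := @continuous_coercive_min F 0
    (Num.sqrt (4 * sqnorm q) / Num.sqrt (m ^+ 2)) cF.
  move=> y yF; apply: coord_le_sqnorm.
  - by rewrite exprn_gt0.
  - exact: sqrtr_ge0.
  rewrite sqr_sqrtr ?mulr_ge0 ?sqnorm_ge0//.
  have D : bregman f c y 0 = F y - F 0 + dotv q y.
    rewrite /bregman /F /q subr0 sq0 d0 dotvDl dotvNl; ring.
  have h1 := bregman_ge c f2 fc y 0; rewrite subr0 D in h1.
  (* Young's inequality [m <q, y> <= |q|^2 + m^2 |y|^2 / 4], combined with [m |y|^2 <= 2 <q, y>]
     from strong convexity and [F y <= F 0], gives [m^2 |y|^2 <= 4 |q|^2]. *)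
  have h2 := sqnorm_ge0 (q + (- (m / 2)) *: y).
  rewrite sqnormD dotvZr sqnormZ in h2.
  by apply: (coercive_arith cm h1 _ h2); rewrite subr_le0.
exists z => v.
pose G (s : R) := f (z + s *: v) +
  (c / 2 * (sqnorm z + (2 * dotv z v * s + sqnorm v * (s * s))) -
   (dotv p z + dotv p v * s)).
have GE (s : R) : F (z + s *: v) = G s.
  by rewrite /F /G sqnormD sqnormZ dotvDr !dotvZr; ring.
have dfl (s : R) : is_derive s 1 (fun s => f (z + s *: v)) (dotv (gradient f (z + s *: v)) v).
  rewrite -(derive_gradient v (df (z + s *: v))); apply: is_derive_line.
  exact: diff_derivable.
have dG (s : R) : is_derive s 1 G (dotv (gradient f (z + s *: v)) v
     + (c / 2 * (2 * dotv z v + sqnorm v * (2 * s)) - dotv p v)).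
  rewrite /G; have := dfl s => dfs; apply: is_derive_eq.
  by rewrite /GRing.scale /=; ring.
have := @derive1_at_min R G (-1) 1 0 _ _ _ _.
have -> : (-1 <= 1 :> R) by lra.
move=> /(_ isT (fun t _ => ex_derive (is_derive := dG t))).
rewrite in_itv /= ltrN10 ltr01 => /(_ isT) H.
have {}H : is_derive (0 : R) 1 G 0.
  by apply: H => t _; rewrite -!GE scale0r addr0; exact: zmin.
have := @derive_val _ _ _ _ _ _ _ H; rewrite (@derive_val _ _ _ _ _ _ _ (dG 0)).
rewrite scale0r addr0 mulr0 mulr0 addr0.
have -> : c / 2 * (2 * dotv z v) = c * dotv z v by field.
by move=> h; lra.
Qed.

Lemma delta_infty_lt_covers (alpha' : R) K (Y : set 'rV[R]_n) (e : R) :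
  c = 1 - alpha' -> (delta_infty alpha' f K Y < e%:E)%E ->
  covers (fun y z => bregman f c y z <= e) Y K%:R.
Proof.
move=> cE /ereal_inf_lt[_ [p [a [a_ny MPle ->]]] lte].
(* Admissibility at the point of tangency [z] reads [phi z - <p k, z> + a (p k) >= 0], which is
   inserted in [bregman_affine]. *)
have zP k : exists z, a (p k) \is a fin_num ->
    forall y, bregman f c y z <= phi y - dotv (p k) y + fine (a (p k)).
  have [z gz] := gradient_surjective (p k); exists z => afin y.
  rewrite (bregman_affine gz) /=.
  have := MPle z; rewrite /Psi_MP -cE => /(le_trans (le_bigmax _ _ k)).
  rewrite -(fineK afin) -EFinB lee_fin => h; lra.
pose z k := sval (cid (zP k)).
exists [seq z k | k <- enum 'I_K]; rewrite size_map size_enum_ord; split=> // y Yy.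
have : (`|(f y)%:E - Psi_MP alpha' p a y| < e%:E)%E.
  by apply: le_lt_trans lte; apply: ereal_sup_ubound; exists y.
move=> ye.
(* If every term were at most [f y - e], so would be their maximum. The bound on the chosen term
   also excludes [a (p k) = +oo]. *)
have [k hk] : exists k : 'I_K, ((f y - e)%:E <
    (dotv (p k) y - c / 2 * sqnorm y)%:E - a (p k))%E.
  apply: contrapT => nk.
  have : (Psi_MP alpha' p a y <= (f y - e)%:E)%E.
    apply: bigmax_le; first by rewrite leNye.
    move=> k _; rewrite -cE leNgt; apply/negP => hk; apply: nk; by exists k.
  move: ye; case: (Psi_MP alpha' p a y) => [r| |]//.
  by rewrite lee_fin -EFinB /= lte_fin ltr_norml => /andP[h1 h2] h3; lra.
have afin : a (p k) \is a fin_num.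
  rewrite fin_numE a_ny /=; apply: contraTN hk => /eqP ->.
  by rewrite -leNgt; exact: leNye.
exists (z k); first by rewrite map_f// mem_enum.
have := svalP (cid (zP k)) afin y; rewrite -/(z k) => /le_trans; apply.
rewrite -(fineK afin) -EFinB lte_fin in hk; lra.
Qed.

End strongly_convex.

(** [Psi_MP] takes intercepts from a function of the slope, while [b] depends on the index and may
    differ at equal slopes; hence an intercept determined by the slope and at least as good as each
    [b k]. *)
Lemma affine_minorants_delta_infty_le (f : 'rV[R]_n -> R) (alpha' : R) K
    (p : 'I_K -> 'rV[R]_n) (b : 'I_K -> R) (Y : set 'rV[R]_n) (e : R) :
  let phi y := f y + (1 - alpha') / 2 * sqnorm y in
  (forall k y, dotv (p k) y - b k <= phi y) ->
  (forall y, Y y -> exists k, phi y - (dotv (p k) y - b k) <= e) ->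
  (delta_infty alpha' f K Y <= e%:E)%E.
Proof.
move=> phi minor near.
(* The convex conjugate of [phi] is the least admissible [a]. *)
pose a q : \bar R := ereal_sup [set (dotv q y - phi y)%:E | y in setT].
have age q y : ((dotv q y - phi y)%:E <= a q)%E by apply: ereal_sup_ubound; exists y.
have ale k : (a (p k) <= (b k)%:E)%E.
  apply: ge_ereal_sup => _ [y _ <-]; rewrite lee_fin.
  by have := minor k y => ?; lra.
have MPle y : (Psi_MP alpha' p a y <= (f y)%:E)%E.
  apply: bigmax_le; first by rewrite leNye.
  move=> k _; apply: (le_trans (leeB (lexx _) (age (p k) y))).
  by rewrite -EFinB lee_fin /phi; lra.
apply: (@le_trans _ _ (ereal_sup [set `|(f y)%:E - Psi_MP alpha' p a y|%E | y in Y])).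
  apply: ereal_inf_lbound; exists p, a; split=> // q.
  rewrite gt_eqF// (lt_le_trans _ (age q 0))// ltNyr//.
apply: ge_ereal_sup => _ [y Yy <-]; have [k hk] := near y Yy.
have MPge : ((f y - e)%:E <= Psi_MP alpha' p a y)%E.
  apply: le_trans (le_bigmax _ _ k).
  apply: (@le_trans _ _ ((dotv (p k) y - (1 - alpha') / 2 * sqnorm y)%:E - (b k)%:E)%E).
    by rewrite -EFinB lee_fin; move: hk; rewrite /phi => ?; lra.
  exact: leeB.
move: (MPle y) MPge; case: (Psi_MP alpha' p a y) => [r| |]//.
rewrite !lee_fin => h1 h2.
by rewrite ger0_norm ?subr_ge0//; lra.
Qed.

End minorants.

(** * The piecewise quadratic minorant *)

Section piecewise_quadratic_minorant.
Context {R : realType} {n : nat}.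
Implicit Types (x y z u v p : 'rV[R]_n).

(** Fermat's rule with derivability at [a] only, because [gradient_contact] has differentiability of
    [S] at a single point. *)
Lemma is_derive_global_min (g : R -> R) (a d : R) :
  is_derive a 1 g d -> (forall s, g a <= g s) -> d = 0.
Proof.
move=> dg gmin; have := ex_derive (is_derive := dg); rewrite /derivable => cg.
have : h^-1 *: ((g \o shift a) (h *: 1) - g a) @[h --> 0^'] --> d.
  by rewrite -(derive_val (is_derive := dg)).
move=> lim; apply/eqP; apply: contrapT => /negP d0.
have nd : 0 < `|d| by rewrite normr_gt0.
have /cvgrPdist_lt /(_ _ nd) [e /= e0 he] := lim.
have test (k : R) : k != 0 -> `|k| < e -> `|d - k^-1 * (g (k + a) - g a)| < `|d|.
  move=> k0 ke; have := he k; rewrite /ball_ /= sub0r normrN => /(_ ke k0).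
  by rewrite /GRing.scale /= mulr1.
have e2 : 0 < e / 2 by rewrite divr_gt0.
have e2e : e / 2 < e by rewrite ltr_pdivrMr// ltr_pMr// ltr1n.
have [dp|dn] := ltP 0 d.
  have := test (- (e / 2)); rewrite oppr_eq0 gt_eqF// normrN gtr0_norm// => /(_ isT e2e).
  rewrite (gtr0_norm dp) ltr_norml => /andP[_].
  rewrite ltrBlDr ltrDl invrN mulNr oppr_gt0 pmulr_rlt0 ?invr_gt0//.
  by rewrite subr_lt0 ltNge gmin.
have {}dn : d < 0 by rewrite lt_neqAle d0.
have := test (e / 2); rewrite gt_eqF// gtr0_norm// => /(_ isT e2e).
rewrite (ltr0_norm dn) ltr_norml => /andP[+ _].
rewrite opprK ltrBrDr gtrDl pmulr_rlt0 ?invr_gt0//.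
by rewrite subr_lt0 ltNge gmin.
Qed.

(** A paraboloid with vertex over [y] touches [S] from above at [x], so both have gradient
    [(x - y) / t] there. *)
Lemma gradient_contact (S : 'rV[R]_n -> R) (t c : R) x y : 0 < t ->
  differentiable S x ->
  (forall z, S z <= (2 * t)^-1 * sqnorm (z - y) + c) ->
  S x = (2 * t)^-1 * sqnorm (x - y) + c ->
  x - t *: gradient S x = y.
Proof.
move=> t0 dS Sle Sx.
suff E v : dotv (gradient S x) v = t^-1 * dotv (x - y) v.
  have -> : gradient S x = t^-1 *: (x - y).
    apply/rowP => i; have := E (delta_mx ord0 i).
    have de u : dotv u (delta_mx ord0 i) = u ord0 i.
      rewrite /dotv (bigD1 i)//= mxE !eqxx mulr1 big1 ?addr0// => j ji.
      by rewrite mxE eqxx /= (negPf ji) mulr0.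
    by rewrite !de => ->; rewrite [RHS]mxE.
  by rewrite scalerA divff ?gt_eqF// scale1r opprB addrCA subrr addr0.
have dSl : is_derive (0 : R) 1 (fun s => S (x + s *: v)) (dotv (gradient S x) v).
  have := @is_derive_line R n S x v 0; rewrite scale0r addr0 derive_gradient//.
  by apply; exact: diff_derivable.
pose G (s : R) := (2 * t)^-1 *
  (sqnorm (x - y) + (2 * dotv (x - y) v * s + sqnorm v * (s * s))) + c - S (x + s *: v).
have dG : is_derive (0 : R) 1 G (t^-1 * dotv (x - y) v - dotv (gradient S x) v).
  rewrite /G; apply: is_derive_eq.
  by rewrite /GRing.scale /=; field; rewrite gt_eqF.
have GE s : G s = (2 * t)^-1 * sqnorm (x + s *: v - y) + c - S (x + s *: v).
  by rewrite /G (addrAC x (s *: v)) (sqnormD (x - y) (s *: v)) sqnormZ dotvZr; ring.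
have G0 : G 0 = 0 by rewrite GE scale0r addr0 Sx subrr.
have Gmin s : G 0 <= G s by rewrite G0 GE subr_ge0.
by have /eqP := is_derive_global_min dG Gmin; rewrite subr_eq0 => /eqP.
Qed.

Lemma lipschitz_bound (J : 'rV[R]_n -> R) : lipschitz J ->
  exists2 L : R, 0 < L & forall x y, `|J x - J y| <= L * `|x - y|.
Proof.
move=> /pinfty_ex_gt0[L L0 hL]; exists L => // x y.
exact: (hL (x, y)).
Qed.

Lemma norm_le_sqnorm v : `|v| <= Num.sqrt (sqnorm v).
Proof.
apply/rV_norm_le; first exact: sqrtr_ge0.
move=> i; rewrite -sqrtr_sqr ler_wsqrtr// /sqnorm /dotv (bigD1 i)//= -expr2.
by rewrite lerDl sumr_ge0// => j _; rewrite -expr2 sqr_ge0.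
Qed.

Let subgradient_arith (Fy Fw Fz N Q xd yd a s : R) : 0 < s ->
  Fy + N / 2 + s * xd <= Fw + (N + 2 * (s * yd) + s ^+ 2 * Q) / 2 ->
  Fw + (1 - a) / 2 * (N + 2 * (s * yd) + s ^+ 2 * Q) <=
    s * (Fz + (1 - a) / 2 * (N + 2 * yd + Q)) + (1 - s) * (Fy + (1 - a) / 2 * N) ->
  Fy + N / 2 + xd + a * (1 - s) / 2 * Q <= Fz + (N + 2 * yd + Q) / 2.
Proof. by move=> s0 h1 h2; rewrite -(ler_pM2l s0); lra. Qed.

Let quadratic_expand x y z (A a : R) :
  A + dotv x (y - z) + a / 2 * sqnorm (y - z) =
  dotv (x - a *: z) y - (dotv x z - A - a / 2 * sqnorm z) + a / 2 * sqnorm y.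
Proof.
rewrite sqnormD sqnormN dotvDl !dotvDr !dotvNr dotvNl dotvZl (dotvC y z).
by field.
Qed.

Section lax_oleinik.
Context (t : R) (S J : 'rV[R]_n -> R).
Context (t0 : 0 < t) (SJ : initial_data t S J).

Lemma lax_oleinik_le x y : S x <= (2 * t)^-1 * sqnorm (x - y) + J y.
Proof.
have [_ SE] := SJ; rewrite -lee_fin SE.
by apply: ereal_inf_lbound; exists y.
Qed.

Lemma lax_oleinik_attained x : exists y, S x = (2 * t)^-1 * sqnorm (x - y) + J y.
Proof.
have [Jl SE] := SJ; have [L L0 hL] := lipschitz_bound Jl.
pose G y := (2 * t)^-1 * sqnorm (y - x) + J y.
have t2 : 0 < 2 * t by rewrite mulr_gt0.
have cJ : continuous J.
  move=> y U /nbhs_ballP[e e0 eU]; apply/nbhs_ballP; exists (e / L) => /=.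
    exact: divr_gt0.
  move=> z; rewrite -ball_normE /= => yz; apply: eU; rewrite -ball_normE /=.
  by rewrite (le_lt_trans (hL _ _))// mulrC -ltr_pdivlMr.
have cq : continuous ((2 * t)^-1 \*: (@sqnorm R n \o (fun y => y - x))).
  move=> y; apply: differentiable_continuous; apply: differentiableZ.
  apply: differentiable_comp; last exact: differentiable_sqnorm.
  by apply: differentiableB.
have cG : continuous G by move=> y; exact: (continuousD (cq y) (cJ y)).
have Gb y : G y <= G x -> forall i, `|y ord0 i| <= `|x| + 2 * t * L.
  rewrite /G subrr -(scale0r (0 : 'rV[R]_n)) sqnormZ expr0n /= mul0r mulr0 add0r => Gyx i.
  have h1 : (2 * t)^-1 * sqnorm (y - x) <= L * `|y - x|.
    by have := hL x y; rewrite (distrC x y) => /(le_trans (ler_norm _)) h; lra.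
  have h2 := norm_le_sqnorm (y - x); set r := Num.sqrt _ in h2.
  have rE : r ^+ 2 = sqnorm (y - x) by rewrite sqr_sqrtr// sqnorm_ge0.
  have r0 : 0 <= r by exact: sqrtr_ge0.
  have h3 : r <= 2 * t * L.
    have [r_gt0|] := ltP 0 r; last by move=> /le_trans; apply; rewrite mulr_ge0// ltW.
    have h4 : (2 * t)^-1 * sqnorm (y - x) <= L * r by rewrite (le_trans h1)// ler_pM2l.
    by rewrite -(ler_pM2r r_gt0) -expr2 rE -[leRHS]mulrA; move: h4; rewrite ler_pdivrMl.
  have -> : y = x + (y - x) by rewrite addrC subrK.
  apply: (le_trans (mx_entry_le_norm _ _ _)); apply: (le_trans (ler_normD _ _)).
  by rewrite lerD2l (le_trans h2).
have [y ymin] := continuous_coercive_min cG Gb; exists y.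
apply/eqP; rewrite eq_le lax_oleinik_le /= -lee_fin SE.
apply: le_ereal_inf_tmp => _ [z _ <-]; rewrite lee_fin.
by have := ymin z; rewrite /G -(opprB x y) -(opprB x z) !sqnormN.
Qed.

Lemma J_BVS_ge x y : S x - (2 * t)^-1 * sqnorm (x - y) <= J_BVS t S y.
Proof.
apply: ub_le_sup; last by exists x.
exists (J y) => _ [z _ <-]; by have := lax_oleinik_le z y; lra.
Qed.

Lemma J_BVS_le y : J_BVS t S y <= J y.
Proof.
apply: ge_sup; first by exists (S 0 - (2 * t)^-1 * sqnorm (0 - y)), 0.
by move=> _ [z _ <-]; have := lax_oleinik_le z y; lra.
Qed.

(** By [gradient_contact] a Lax-Oleinik minimiser at [x] must be [y]; there the bounds [J_BVS_le]
    and [J_BVS_ge] coincide. *)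
Lemma J_BVS_contact x (y := x - t *: gradient S x) : differentiable S x ->
  J_BVS t S y = S x - (2 * t)^-1 * sqnorm (x - y).
Proof.
move=> dS; have [z Sz] := lax_oleinik_attained x.
have yE : y = z.
  apply: (gradient_contact t0 dS (c := J z)) => // u; exact: lax_oleinik_le.
apply/eqP; rewrite eq_le J_BVS_ge andbT yE.
by apply: (le_trans (J_BVS_le z)); rewrite Sz; lra.
Qed.

Lemma J_BVS_subgradient x z (y := x - t *: gradient S x) : differentiable S x ->
  t * J_BVS t S y + sqnorm y / 2 + dotv x (z - y) <= t * J_BVS t S z + sqnorm z / 2.
Proof.
move=> dS; have C := J_BVS_contact dS; rewrite -/y in C; clearbody y; rewrite C.
have := J_BVS_ge x z; rewrite -(ler_pM2l t0) !mulrBr.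
have t20 : 2 * t != 0 by rewrite mulf_neq0// gt_eqF.
have tt q : t * ((2 * t)^-1 * q) = q / 2 by field; rewrite gt_eqF.
rewrite !tt !sqnormD !sqnormN !dotvDr !dotvNr => h; lra.
Qed.

(** Strong convexity would give the coefficient [alpha] in the limit [s -> 0]; as [alpha' < alpha],
    one fixed [s > 0] already gives [alpha']. *)
Lemma J_BVS_strong_subgradient (alpha alpha' : R) x z (y := x - t *: gradient S x) :
  semiconvex (1 - alpha) (fun y => t * J_BVS t S y) -> 0 < alpha' < alpha ->
  differentiable S x ->
  t * J_BVS t S y + sqnorm y / 2 + dotv x (z - y) + alpha' / 2 * sqnorm (z - y)
    <= t * J_BVS t S z + sqnorm z / 2.
Proof.
move=> sc /andP[a'0 a'a] dS; have a0 : 0 < alpha by exact: lt_trans a'a.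
(* Subgradient inequality at [s z + (1 - s) y], [s] chosen so that
   [alpha (1 - s) = alpha']. *)
pose s := (alpha - alpha') / alpha.
have s0 : 0 < s by rewrite divr_gt0// subr_gt0.
have s1 : s <= 1 by rewrite ler_pdivrMr// mul1r lerBlDr lerDl ltW.
have sE : alpha' = alpha * (1 - s) by rewrite /s; field; rewrite gt_eqF.
have s01 : 0 <= s <= 1 by rewrite ltW.
have := convex_functionP z y sc s01; have := J_BVS_subgradient (s *: z + (1 - s) *: y) dS.
rewrite -/y; clearbody y; have zE : z = y + (z - y) by rewrite addrC subrK.
move: (z - y) zE => d ->; rewrite sE.
have -> : s *: (y + d) + (1 - s) *: y = y + s *: d.
  by apply/rowP => i; rewrite !mxE; ring.
have -> : y + s *: d - y = s *: d by rewrite addrAC subrr add0r.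
rewrite !sqnormD !sqnormZ !dotvZr.
exact: subgradient_arith s0.
Qed.

Lemma fine_bigmaxe K (B : 'I_K -> R) : (1 <= K)%N ->
  exists k, fine (\big[maxe/-oo%E]_(k < K) (B k)%:E) = B k.
Proof.
move=> K1.
have [k _ ->] := @eq_bigmax _ _ _ -oo%E (Ordinal K1) xpredT (fun k => (B k)%:E)
  isT (fun k _ => leNye _).
by exists k.
Qed.

Lemma delta_infty_le_PQM (alpha alpha' : R) (Y : set 'rV[R]_n) K (x : 'I_K -> 'rV[R]_n) :
  semiconvex (1 - alpha) (fun y => t * J_BVS t S y) -> 0 < alpha' < alpha ->
  Y !=set0 -> (1 <= K)%N -> (forall k, differentiable S (x k)) ->
  (delta_infty alpha' (fun y => t * J_BVS t S y)%R K Y <=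
    t%:E * ereal_sup [set `|(J y - J_PQM t S alpha' x y)%R|%:E | y in Y])%E.
Proof.
move=> sc aa' [y0 Yy0] K1 dS; set M := ereal_sup _.
have Mge y : Y y -> ((`|J y - J_PQM t S alpha' x y|%R)%:E <= M)%E.
  by move=> Yy; apply: ereal_sup_ubound; exists y.
(* The bound is trivial for [M = +oo], and the point [y0] excludes [M = -oo]. *)
have M0 := Mge y0 Yy0; clearbody M; case: M Mge M0 => [r| |] Mge M0 //; last first.
  by rewrite gt0_muley ?lte_fin// leey.
rewrite -EFinM.
pose yk k := x k - t *: gradient S (x k).
pose A k := t * J_BVS t S (yk k) + sqnorm (yk k) / 2.
pose B k y := A k + dotv (x k) (y - yk k) + alpha' / 2 * sqnorm (y - yk k).
(* All [B k] have curvature [alpha']; removing [alpha' / 2 * |y|^2] leaves an affine function of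
   slope [p k] and intercept [- b k]. *)
pose p k := x k - alpha' *: yk k.
pose b k := dotv (x k) (yk k) - A k - alpha' / 2 * sqnorm (yk k).
have BE k y : B k y = dotv (p k) y - b k + alpha' / 2 * sqnorm y.
  exact: quadratic_expand.
have Ble k y : B k y <= t * J_BVS t S y + sqnorm y / 2.
  exact: (J_BVS_strong_subgradient y sc aa' (dS k)).
apply: (@affine_minorants_delta_infty_le _ _ _ _ _ p b) => [k y|y Yy].
  by have := Ble k y; rewrite BE => h; lra.
have [k hk] := fine_bigmaxe (fun k => B k y) K1; exists k.
have h1 := Mge y Yy; rewrite lee_fin in h1.
have tJ : t * J_PQM t S alpha' x y = B k y - sqnorm y / 2.
  by rewrite /J_PQM hk mulrA divff ?mul1r// gt_eqF.
have h2 : t * (J y - J_PQM t S alpha' x y) <= t * r.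
  by rewrite ler_pM2l// (le_trans (ler_norm _)).
have h3 : t * J_BVS t S y <= t * J y by rewrite ler_pM2l// J_BVS_le.
rewrite BE in tJ; rewrite mulrBr tJ in h2; lra.
Qed.

End lax_oleinik.

End piecewise_quadratic_minorant.

(** * From covering numbers to the error *)

Section threshold.
Context {R : realType}.

Lemma radius_cvg0 n (A : R) (e : R) : (0 < n)%N -> 0 < A -> 0 < e ->
  exists2 N : nat, (0 < N)%N & forall K, (N <= K)%N ->
    0 < (K%:R^-1 * A) `^ (n%:R^-1) < e.
Proof.
move=> n0 A0 e0; have en : 0 < e ^+ n by exact: exprn_gt0.
exists (Num.truncn (A / e ^+ n)).+1 => // K NK.
have K0 : 0 < K%:R :> R by rewrite ltr0n (leq_trans _ NK).
rewrite powR_gt0 ?mulr_gt0 ?invr_gt0//=.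
have AK : K%:R^-1 * A < e ^+ n.
  rewrite ltr_pdivrMl// -ltr_pdivrMr//.
  by apply: (lt_le_trans (truncnS_gt _)); rewrite ler_nat.
have -> : e = (e ^+ n) `^ (n%:R^-1).
  by rewrite -powR_mulrn ?(ltW e0)// -powRrM mulfV ?pnatr_eq0 -?lt0n// powRr1// ltW.
by rewrite gt0_ltr_powR ?invr_gt0 ?ltr0n// ?nnegrE ?(ltW en)// mulr_ge0 ?invr_ge0 ?ltW.
Qed.

Lemma radiusXn n (A : R) K : (0 < n)%N -> 0 < A -> (0 < K)%N ->
  ((K%:R^-1 * A) `^ (n%:R^-1)) ^+ n = K%:R^-1 * A.
Proof.
move=> n0 A0 K0; rewrite -powR_mulrn ?powR_ge0// -powRrM mulVf ?pnatr_eq0 -?lt0n//.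
by rewrite powRr1// mulr_ge0// ltW.
Qed.

Lemma radius_sqr n (A : R) K :
  ((K%:R^-1 * A) `^ (n%:R^-1)) ^+ 2 = (K%:R^-1 * A) `^ (2 / n%:R).
Proof. by rewrite -powR_mulrn ?powR_ge0// -powRrM (mulrC n%:R^-1). Qed.

(** [rK K] solves [K r ^ n = A]. The first hypothesis at radius [tau * rK K] and the second at
    [rK K / tau] enclose [d K] between [tau ^- 2] and [tau ^+ 2] times [rK K ^+ 2 / 2]. *)
Lemma threshold_cvg n (d : nat -> \bar R) (A : R) : (0 < n)%N -> 0 < A ->
  (forall nu : R, 1 < nu -> exists2 r0 : R, 0 < r0 & forall (r : R) K, 0 < r < r0 ->
     nu * A <= K%:R * r ^+ n -> (d K <= (r ^+ 2 / 2)%:E)%E) ->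
  (forall nu : R, 1 < nu -> exists2 r0 : R, 0 < r0 & forall (r : R) K, 0 < r < r0 ->
     (d K < (r ^+ 2 / 2)%:E)%E -> A <= nu * K%:R * r ^+ n) ->
  (fun K => d K / ((K%:R^-1 * A) `^ (2 / n%:R) / 2)%:E)%E @ \oo --> 1%E.
Proof.
move=> n0 A0 U L; pose rK K := (K%:R^-1 * A) `^ (n%:R^-1).
pose rate K := rK K ^+ 2 / 2.
have key (tau : R) : 1 < tau -> exists2 N : nat, (0 < N)%N & forall K, (N <= K)%N ->
    0 < rate K /\ ((tau ^- 2 * rate K)%:E <= d K <= (tau ^+ 2 * rate K)%:E)%E.
  move=> tau1; have tau0 : 0 < tau by exact: lt_trans tau1.
  (* Strictly between 1 and [tau], hence below [tau ^+ n] as [n >= 1]; strictness yields the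
     contradiction in the lower bound. *)
  pose nu := (1 + tau) / 2; have nu1 : 1 < nu by rewrite /nu; lra.
  have nutau : nu < tau ^+ n.
    apply: (@lt_le_trans _ _ tau); first by rewrite /nu; lra.
    by rewrite -[leLHS]expr1; apply: ler_weXn2l => //; exact: ltW.
  have [r1 r10 h1] := U nu nu1; have [r2 r20 h2] := L nu nu1.
  have e0 : 0 < Num.min (r1 / tau) r2 by rewrite lt_min divr_gt0.
  have [N N0 hN] := radius_cvg0 n0 A0 e0; exists N => // K NK.
  have K0 : (0 < K)%N by exact: leq_trans NK.
  have KR : 0 < K%:R :> R by rewrite ltr0n.
  have /andP[rK0] := hN K NK; rewrite -/(rK K) lt_min => /andP[rK1 rK2].
  have rKn : K%:R * rK K ^+ n = A by rewrite radiusXn// mulVKf// gt_eqF.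
  have taun : 0 < tau ^+ n by exact: exprn_gt0.
  split; first by rewrite divr_gt0// exprn_gt0.
  apply/andP; split; last first.
    have -> : tau ^+ 2 * rate K = (tau * rK K) ^+ 2 / 2 by rewrite exprMn mulrA.
    apply: h1; first by rewrite mulr_gt0//= mulrC -ltr_pdivlMr.
    by rewrite exprMn mulrCA rKn ler_pM2r// ltW.
  rewrite leNgt; apply/negP.
  have -> : tau ^- 2 * rate K = (rK K / tau) ^+ 2 / 2 by rewrite expr_div_n /rate; ring.
  move=> /h2; rewrite divr_gt0//= => /(_ _)/=.
  rewrite ltr_pdivrMr// => /(_ _).
  have -> : rK K < r2 * tau.
    by rewrite (lt_trans rK2)// ltr_pMr.
  have -> : nu * K%:R * (rK K / tau) ^+ n = nu / tau ^+ n * (K%:R * rK K ^+ n).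
    by rewrite expr_div_n; ring.
  by rewrite rKn => /(_ isT); rewrite leNgt gtr_pMl// ltr_pdivrMr// mul1r nutau.
have sqE K : (K%:R^-1 * A) `^ (2 / n%:R) / 2 = rate K by rewrite /rate radius_sqr.
under eq_fun do rewrite sqE.
have fin (e : R) : 0 < e -> \forall K \near \oo,
    ((d K / (rate K)%:E)%E \is a fin_num) /\ `|1 - fine (d K / (rate K)%:E)%E| <= e.
  (* With [e' <= 1], [(1 - e') * (1 + e') <= 1] turns [tau ^+ 2 <= 1 + e'] into
     [1 - e' <= tau ^- 2]. *)
  move=> e0; pose e' := Num.min e 1.
  have e'0 : 0 < e' by rewrite lt_min e0 /=.
  have e'e : e' <= e by rewrite ge_min lexx.
  have [|tau tau1 tau2] := @exp_root_gt1 R (1 + e') 2; first by rewrite ltrDl.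
  have tau0 : 0 < tau ^+ 2 by rewrite exprn_gt0// (lt_trans _ tau1).
  have [N N0 hN] := key tau tau1; exists N => // K /= NK.
  have [r0 /andP[l1 l2]] := hN K NK.
  have dfin : d K \is a fin_num.
    by rewrite fin_numElt (lt_le_trans _ l1) ?ltNyr//= (le_lt_trans l2)// ltry.
  rewrite -(fineK dfin) in l1 l2 *; rewrite !lee_fin in l1 l2.
  have -> : ((fine (d K))%:E / (rate K)%:E)%E = (fine (d K) / rate K)%:E.
    by rewrite inver gt_eqF// EFinM.
  split=> //=; set q := fine (d K) / rate K.
  have q1 : q <= tau ^+ 2 by rewrite ler_pdivrMr.
  have q2 : tau ^- 2 <= q by rewrite ler_pdivlMr.
  have q3 : 1 - e' <= q.
    apply: le_trans q2; rewrite -[leRHS]mul1r ler_pdivlMr//.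
    have : 0 <= 1 - e' by rewrite subr_ge0 ge_min lexx orbT.
    move=> h; have := ler_wpM2l h tau2; nra.
  by rewrite ler_norml; apply/andP; split; lra.
apply/fine_cvgP; split.
  by have := fin 1 ltr01; apply: filterS => K [].
apply/cvgrPdist_le => e e0; have := fin e e0; apply: filterS => K [_].
by [].
Qed.

End threshold.

(** * Scaling of the Hessian, tangent-plane approximants and assembly *)

Lemma derive_partialZ {R : realType} {n : nat} (f : 'rV[R]_n -> R) (k : R) i :
  (forall x, differentiable f x) ->
  'D_(delta_mx ord0 i) (k \*: f) = k \*: 'D_(delta_mx ord0 i) f.
Proof. by move=> df; apply/funext => x; rewrite deriveZ//; exact: diff_derivable. Qed.

Lemma hessianZ {R : realType} {n : nat} (f : 'rV[R]_n -> R) (k : R) x :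
  twice_continuously_differentiable f -> hessian (k \*: f) x = k *: hessian f x.
Proof.
move=> [df dg _]; apply/matrixP => i j; rewrite [LHS]mxE [RHS]mxE [X in _ = _ * X]mxE.
rewrite derive_partialZ// deriveZ//.
exact/diff_derivable/differentiable_partial.
Qed.

Lemma interior_cube {R : realType} {n : nat} (Y : set 'rV[R]_n) : Y° !=set0 ->
  exists p, exists2 rho : R, 0 < rho & forall y, coord_dist_le y p rho -> Y y.
Proof.
move=> [p /nbhs_ballP[e /= e0 eY]]; exists p, (e / 2); first by rewrite divr_gt0.
move=> y yp; apply: eY; rewrite -ball_normE /=.
have : `|p - y| <= e / 2.
  apply/rV_norm_le => [|i]; first by rewrite ltW// divr_gt0.
  by have := yp i; rewrite distrC !mxE.
by move=> /le_lt_trans; apply; rewrite ltr_pdivrMr// ltr_pMr// ltr1n.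
Qed.

Lemma compact_coord_bounded {R : realType} {n : nat} (Y : set 'rV[R]_n) : compact Y ->
  exists B : R, forall y i, Y y -> `|y ord0 i| <= B.
Proof.
move=> /compact_bounded[M [_ hM]]; exists (M + 1) => y i Yy.
by apply: (le_trans (mx_entry_le_norm y ord0 i)); apply: hM => //; rewrite ltrDl.
Qed.

Lemma covers_delta_infty_le {R : realType} {n : nat} (f : 'rV[R]_n -> R)
    (alpha alpha' : R) K (Y : set 'rV[R]_n) (r : R) :
  twice_continuously_differentiable f -> semiconvex (1 - alpha) f ->
  0 < 1 - alpha' - (1 - alpha) ->
  covers (fun y z => 2 * bregman f (1 - alpha') y z <= r ^+ 2) Y K%:R ->
  (delta_infty alpha' f K Y <= (r ^+ 2 / 2)%:E)%E.
Proof.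
move=> f2 fc cm [z [zK hz]]; set c := 1 - alpha' in cm hz.
(* There may be fewer than [K] centres; the default [0] pads with the tangent plane at the origin,
   also a minorant. *)
pose w (k : 'I_K) := nth 0 z k.
pose p k := gradient f (w k) + c *: w k.
pose b k := dotv (p k) (w k) - (f (w k) + c / 2 * sqnorm (w k)).
have D k y : bregman f c y (w k) = f y + c / 2 * sqnorm y - (dotv (p k) y - b k).
  rewrite (@bregman_affine _ _ f c (p k)) => [|v]; first by rewrite /b; ring.
  by rewrite /p dotvDl dotvZl addrK.
apply: (@affine_minorants_delta_infty_le _ _ _ _ _ p b) => [k y|y Yy].
  rewrite -subr_ge0 -/c -D -(pmulr_rge0 _ (ltr0n R 2)).
  by apply: le_trans (bregman_ge c f2 fc y (w k)); rewrite mulr_ge0 ?(ltW cm)// sqnorm_ge0.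
have [q qz Dq] := hz y Yy.
have iK : (index q z < K)%N.
  by rewrite -(ltr_nat R) (lt_le_trans _ zK)// ltr_nat index_mem.
exists (Ordinal iK); rewrite -/c -D /w /= nth_index//.
by rewrite ler_pdivlMr// mulrC.
Qed.

Theorem corollary4p3 (R : realType) (n : nat) (n_ge1 : (1 <= n)%N) :
  exists beta : R, 0 < beta /\
  forall (t : R) (S Jtilde : 'rV[R]_n -> R) (alpha alpha' : R)
    (Y : set 'rV[R]_n),
    let Psi y := t * J_BVS t S y in
    let rate (K : nat) : R :=
      beta *
      ((K%:R^-1 *
        \int[lebesgue_rV n]_(y in Y)
          (Num.sqrt (\det (t *: hessian (J_BVS t S) y + (1 - alpha')%:M))))
       `^ (2 / n%:R)) in
    0 < t ->
    lipschitz S ->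
    initial_data t S Jtilde ->
    twice_continuously_differentiable Psi ->
    0 < alpha ->
    semiconvex (1 - alpha) Psi ->
    0 < alpha' < alpha ->
    compact Y -> convex_set Y -> Y° !=set0 ->
    ((fun K : nat => delta_infty alpha' Psi K Y / (rate K)%:E)%E
       @ \oo --> 1%E) /\
    (forall (K : nat) (x : 'I_K -> 'rV[R]_n),
       (1 <= K)%N ->
       (forall k, differentiable S (x k)) ->
       (delta_infty alpha' Psi K Y <=
        t%:E * ereal_sup [set `|(Jtilde y - J_PQM t S alpha' x y)%R|%:E
                         | y in Y])%E).
Proof.
pose kappa := covering_constant (1%:M : 'M[R]_n).
have kappa0 : 0 < kappa by exact: covering_constant1_gt0.
exists (2^-1 * kappa `^ (2 / n%:R)); split.
  by rewrite mulr_gt0 ?invr_gt0// powR_gt0.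
move=> t S Jt alpha alpha' Y Psi rate t0 _ SJ Psi2 _ Psic aa' cY xY iY.
have [p [rho0 rho00 pY]] := interior_cube iY.
have [p0 Yp0] : Y !=set0.
  by exists p; apply: pY => i; rewrite subrr normr0 ltW.
split; last first.
  move=> K x K1 dS.
  by apply: (delta_infty_le_PQM t0 SJ Psic aa') => //; exists p0.
have cm : 0 < 1 - alpha' - (1 - alpha).
  by have /andP[_ h] := aa'; rewrite opprB addrCA addrAC subrr add0r subr_gt0.
have [B YB] := compact_coord_bounded cY.
(* Regularity is assumed of [Psi], so the derivatives of [J_BVS] are recovered from it by
   scaling. *)
have JE : J_BVS t S = t^-1 \*: Psi.
  by apply/funext => y; rewrite /Psi /= /GRing.scale /= mulrA mulVf ?mul1r// gt_eqF.
have HE y : t *: hessian (J_BVS t S) y + (1 - alpha')%:M =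
    shifted_hessian Psi (1 - alpha') y.
  by rewrite {1}JE hessianZ// scalerA mulfV ?gt_eqF// scale1r.
have pd := shifted_hessian_posdef Psi2 Psic cm.
have lq := bregman_locally_quadratic Psi2 Psic cm cY.
have [IE I0] := integral_finite_gt0 rho00 pd lq xY YB pY.
have cu := bregman_cover_upper cm rho00 pd
  (shifted_hessian_ge (1 - alpha') Psi2 Psic) lq xY YB pY.
have cl := bregman_cover_lower cm rho00 pd
  (bregman_ge (1 - alpha') Psi2 Psic) lq xY YB pY.
pose I := fine (\int[lebesgue_rV n]_(y in Y)
  (Num.sqrt (\det (shifted_hessian Psi (1 - alpha') y)))%:E)%E.
have rateE K : rate K = (K%:R^-1 * (kappa * I)) `^ (2 / n%:R) / 2.
  rewrite /rate /Rintegral.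
  under eq_integral do rewrite HE.
  rewrite -/I (mulrCA _ kappa I).
  have KI : 0 <= K%:R^-1 * I by rewrite mulr_ge0 ?invr_ge0 ?ler0n// ltW.
  by rewrite (powRM _ (ltW kappa0) KI); ring.
under eq_fun do rewrite rateE.
apply: threshold_cvg => //; first exact: mulr_gt0.
  move=> nu nu1; have [r0 r00 hr] := cu nu nu1; exists r0 => // r K rr0 hK.
  apply: (covers_delta_infty_le Psi2 Psic cm).
  apply: (covers_sub (hr r rr0)) => //.
  by rewrite ler_pdivrMr// exprn_gt0//; case/andP: rr0.
move=> nu nu1; have [r0 r00 hr] := cl nu nu1; exists r0 => // r K rr0 hK.
apply: (hr r K%:R rr0).
have := delta_infty_lt_covers Psi2 Psic cm erefl hK.
move=> /covers_sub; apply=> // y z _.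
by rewrite ler_pdivlMr// mulrC.
Qed.
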